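(* Let $\mathcal{A}$ be a quasi-abelian category equipped with a rank function and a $\Lambda$-valued slope function $\mu$, where $\Lambda$ is a totally ordered, uniquely divisible abelian group. If $f: M \to N$ is a morphism in $W\mathcal{A}^{\mathrm{pre}}$ with $M \in W\mathcal{A}^{\mathrm{pre}}_{\mathrm{udq}}$ and $N \in W\mathcal{A}^{\mathrm{pre}}_{\mathrm{uds}}$, then $f$ is strict in $W\mathcal{A}^{\mathrm{pre}}$ and $\mathrm{Coim} f \cong \mathrm{Im} f \in W\mathcal{A}$ (coimage and image formed in $W\mathcal{A}^{\mathrm{pre}}$).
   Context: All categories are essentially small. In an additive category with kernels and cokernels, put $\mathrm{Coim} f = \mathrm{Coker}(\ker f)$ and $\mathrm{Im} f = \mathrm{Ker}(\mathrm{coker} f)$; $f$ is strict if the canonical morphism $\mathrm{Coim} f \to \mathrm{Im} f$ is an isomorphism. Strict monics are exactly the kernels, strict epis exactly the cokernels. Subobject = monic, quotient = epi; they are called strict if the morphism is strict. A sequence $0 \to M \xrightarrow{f} N \xrightarrow{g} P \to 0$ is short exact if $f = \ker g$ and $g = \mathrm{coker} f$. A quasi-abelian category is an additive category with kernels and cokernels in which kernels are stable under pushout and cokernels are stable under pullback. Slope functions. A rank function $\mathrm{rk}$ assigns to each isomorphism class of $\mathcal{A}$ a natural number, is additive along short exact sequences, and is nonzero on nonzero objects. A degree function $\deg$ assigns to each isomorphism class an element of $\Lambda$ and is additive along short exact sequences. $\mu = \deg/\mathrm{rk}$ (defined on nonzero objects) is a slope function if for every epi-monic $\varphi: M \to N$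 in $\mathcal{A}$ one has $\mu(M) \leq \mu(N)$, with equality if and only if $\varphi$ is an isomorphism. A nonzero object $M$ is semistable if $\mu(N) \leq \mu(M)$ for all nonzero subobjects $N \to M$. $\mathcal{A}(\lambda) \subset \mathcal{A}$ denotes the full subcategory consisting of zero and the semistable objects of slope $\lambda$. Filtrations. $\mathrm{Fun}(\Lambda,\mathcal{A})$ is the category of functors from the totally ordered set $\Lambda$ to $\mathcal{A}$. $W\mathcal{A}^{\mathrm{pre}} \subset \mathrm{Fun}(\Lambda,\mathcal{A})$ is the full subcategory of finite ascending filtrations: functors $\lambda \mapsto W_{\leq\lambda}M$ with colimit $M$ such that each $W_{\leq\lambda}M \to M$ is a strict monic and there are finitely many breaks $\lambda_0 < \dots < \lambda_r$ such that $W_{\leq\lambda}M = 0$ for $\lambda < \lambda_0$, $W_{\leq\lambda}M = W_{\leq\lambda_{i-1}}M$ for $\lambda_{i-1} \leq \lambda < \lambda_i$, and $W_{\leq\lambda}M = M$ for $\lambda \geq \lambda_r$ (no breaks if $M=0$). Objects are written $(M,W)$ or $M$. Put $W_{<\lambda}M = \mathrm{colim}_{\lambda'<\lambda} W_{\leq\lambda'}M$ and $\mathrm{gr}^W_\lambda M = \mathrm{Coker}(W_{<\lambda}M \hookrightarrow W_{\leq\lambda}M)$. $W\mathcal{A}^{\mathrm{pre}}$ is an additive category with kernels and cokernels. $W\mathcal{A} \subset W\mathcal{A}^{\mathrm{pre}}$ is the full subcategory of $(M,W)$ with $\mathrm{gr}^W_\lambda M \in \mathcal{A}(\lambda)$ for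 all $\lambda \in \Lambda$. $W\mathcal{A}^{\mathrm{pre}}_{\mathrm{uds}} \subset W\mathcal{A}^{\mathrm{pre}}$ is the full subcategory of $(M,W)$ such that for all $\lambda \in \Lambda$, all nonzero subobjects of $\mathrm{gr}^W_\lambda M$ have slope $\leq \lambda$. $W\mathcal{A}^{\mathrm{pre}}_{\mathrm{udq}} \subset W\mathcal{A}^{\mathrm{pre}}$ is the full subcategory of $(M,W)$ such that for all $\lambda$, all nonzero quotients of $\mathrm{gr}^W_\lambda M$ have slope $\geq \lambda$. *)

(* Defs.v *)
From HB Require Import structures.
From mathcomp Require Import all_boot all_order all_algebra.
From mathcomp Require Import boolp classical_sets.

Set Implicit Arguments.
Unset Strict Implicit.
Unset Printing Implicit Defensive.

Import Order.TTheory GRing.Theory Num.Theory.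
Local Open Scope ring_scope.

Record preadditive := Preadditive {
  ob :> Type;
  Mor : ob -> ob -> zmodType;
  idm : forall M, Mor M M;
  compm : forall M N P, Mor N P -> Mor M N -> Mor M P;
  comp1m : forall M N (f : Mor M N), compm (idm N) f = f;
  compm1 : forall M N (f : Mor M N), compm f (idm M) = f;
  compmA : forall M N P Q (h : Mor P Q) (g : Mor N P) (f : Mor M N),
    compm h (compm g f) = compm (compm h g) f;
  compmDl : forall M N P (g g' : Mor N P) (f : Mor M N),
    compm (g + g') f = compm g f + compm g' f;
  compmDr : forall M N P (g : Mor N P) (f f' : Mor M N),
    compm g (f + f') = compm g f + compm g f'
}.

Arguments Mor {p} M N.
Arguments idm {p} M.
Arguments compm {p M N P} g f.

Declare Scope cat_scope.
Delimit Scope cat_scope with cat.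
Notation "g ∘ f" := (compm g f) (at level 40, left associativity) : cat_scope.
Open Scope cat_scope.

Section Preadditive.
Variable C : preadditive.
Implicit Types K M N P Q X Y Z : C.

(* Hom groups are never empty, so this says that Z is initial and terminal. *)
Definition is_zero Z : Prop :=
  forall X, (forall f : Mor Z X, f = 0) /\ (forall f : Mor X Z, f = 0).

Definition is_monic M N (f : Mor M N) : Prop :=
  forall X (g h : Mor X M), f ∘ g = f ∘ h -> g = h.

Definition is_epi M N (f : Mor M N) : Prop :=
  forall X (g h : Mor N X), g ∘ f = h ∘ f -> g = h.

Definition is_iso M N (f : Mor M N) : Prop :=
  exists g : Mor N M, g ∘ f = idm M /\ f ∘ g = idm N.

Definition isomorphic M N : Prop := exists f : Mor M N, is_iso f.

Definition is_ker M N (f : Mor M N) K (k : Mor K M) : Prop :=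
  f ∘ k = 0 /\
  forall X (g : Mor X M), f ∘ g = 0 -> exists! u : Mor X K, k ∘ u = g.

Definition is_coker M N (f : Mor M N) Q (q : Mor N Q) : Prop :=
  q ∘ f = 0 /\
  forall X (g : Mor N X), g ∘ f = 0 -> exists! u : Mor Q X, u ∘ q = g.

Definition is_biproduct M N P
    (i : Mor M P) (j : Mor N P) (p : Mor P M) (q : Mor P N) : Prop :=
  [/\ p ∘ i = idm M, q ∘ j = idm N, q ∘ i = 0, p ∘ j = 0
    & i ∘ p + j ∘ q = idm P].

Definition additive_category : Prop :=
  (exists Z, is_zero Z) /\
  (forall M N, exists P (i : Mor M P) (j : Mor N P) (p : Mor P M) (q : Mor P N),
     is_biproduct i j p q).

Definition has_kernels : Prop :=
  forall M N (f : Mor M N), exists K (k : Mor K M), is_ker f k.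

Definition has_cokernels : Prop :=
  forall M N (f : Mor M N), exists Q (q : Mor N Q), is_coker f q.

Definition is_coim M N (f : Mor M N) P (p : Mor M P) : Prop :=
  exists K (k : Mor K M), is_ker f k /\ is_coker k p.

Definition is_im M N (f : Mor M N) P (i : Mor P N) : Prop :=
  exists Q (q : Mor N Q), is_coker f q /\ is_ker q i.

(* The canonical morphism Coim f -> Im f is the unique u with i ∘ u ∘ p = f. *)
Definition is_strict M N (f : Mor M N) : Prop :=
  exists P (p : Mor M P) Q (i : Mor Q N) (u : Mor P Q),
    [/\ is_coim f p, is_im f i, i ∘ u ∘ p = f & is_iso u].

Definition is_pushout M N P Q
    (f : Mor M N) (g : Mor M P) (f' : Mor P Q) (g' : Mor N Q) : Prop :=
  g' ∘ f = f' ∘ g /\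
  forall X (a : Mor N X) (b : Mor P X), a ∘ f = b ∘ g ->
    exists! u : Mor Q X, u ∘ g' = a /\ u ∘ f' = b.

Definition is_pullback M N P Q
    (f : Mor M N) (g : Mor P N) (f' : Mor Q P) (g' : Mor Q M) : Prop :=
  f ∘ g' = g ∘ f' /\
  forall X (a : Mor X M) (b : Mor X P), f ∘ a = g ∘ b ->
    exists! u : Mor X Q, g' ∘ u = a /\ f' ∘ u = b.

Definition is_kernel_map K M (k : Mor K M) : Prop :=
  exists N (f : Mor M N), is_ker f k.

Definition is_cokernel_map N Q (q : Mor N Q) : Prop :=
  exists M (f : Mor M N), is_coker f q.

Definition quasi_abelian : Prop :=
  [/\ additive_category, has_kernels, has_cokernels,
      (forall M N P Q (f : Mor M N) (g : Mor M P) (f' : Mor P Q) (g' : Mor N Q),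
         is_pushout f g f' g' -> is_kernel_map f -> is_kernel_map f')
    & (forall M N P Q (f : Mor M N) (g : Mor P N) (f' : Mor Q P) (g' : Mor Q M),
         is_pullback f g f' g' -> is_cokernel_map f -> is_cokernel_map f')].

Definition short_exact M N P (f : Mor M N) (g : Mor N P) : Prop :=
  is_ker g f /\ is_coker f g.

End Preadditive.

Section FullSubcategory.
Variables (C : preadditive) (P : C -> Prop).

Definition full_sub : preadditive := {|
  ob := {M : C | P M};
  Mor := fun M N => Mor (sval M) (sval N);
  idm := fun M => idm (sval M);
  compm := fun M N Q g f => g ∘ f;
  comp1m := fun M N f => comp1m f;
  compm1 := fun M N f => compm1 f;
  compmA := fun M N Q R h g f => compmA h g f;
  compmDl := fun M N Q g g' f => compmDl g g' f;
  compmDr := fun M N Q g f f' => compmDr g f f' |}.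

End FullSubcategory.

Section Functors.
Variables (L : porderZmodType) (A : preadditive).

Record lfunctor := LFunctor {
  fob :> L -> A;
  fmap : forall l m : L, l <= m -> Mor (fob l) (fob m);
  fmap_id : forall (l : L) (h : l <= l), fmap h = idm (fob l);
  fmap_comp : forall (l m n : L) (hlm : l <= m) (hmn : m <= n) (hln : l <= n),
    fmap hln = fmap hmn ∘ fmap hlm
}.

Record nattrans (V W : lfunctor) := NatTrans {
  ntc :> forall l : L, Mor (V l) (W l);
  nt_natural : forall (l m : L) (h : l <= m), ntc m ∘ fmap V h = fmap W h ∘ ntc l
}.

Lemma nattrans_ext (V W : lfunctor) (f g : nattrans V W) :
  (forall l, f l = g l) -> f = g.
Proof.
case: f g => [f nf] [g ng] /= fg.
have {}fg : f = g by apply: functional_extensionality_dep.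
by rewrite -{}fg in ng *; congr NatTrans; apply: Prop_irrelevance.
Qed.

Lemma compm0 (M N P : A) (g : Mor N P) : g ∘ (0 : Mor M N) = 0.
Proof. by apply: (@addrI _ (g ∘ 0)); rewrite -compmDr !addr0. Qed.

Lemma comp0m (M N P : A) (f : Mor M N) : (0 : Mor N P) ∘ f = 0.
Proof. by apply: (@addrI _ (0 ∘ f)); rewrite -compmDl !addr0. Qed.

Lemma compmN (M N P : A) (g : Mor N P) (f : Mor M N) : g ∘ (- f) = - (g ∘ f).
Proof. by apply/eqP; rewrite -addr_eq0 -compmDr addNr compm0. Qed.

Lemma compNm (M N P : A) (g : Mor N P) (f : Mor M N) : (- g) ∘ f = - (g ∘ f).
Proof. by apply/eqP; rewrite -addr_eq0 -compmDl addNr comp0m. Qed.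

Section NatTransZmodule.
Variables V W : lfunctor.

Fact nt_zero_subproof (l m : L) (h : l <= m) :
  (0 : Mor (V m) (W m)) ∘ fmap V h = fmap W h ∘ 0.
Proof. by rewrite comp0m compm0. Qed.

Definition nt_zero : nattrans V W :=
  @NatTrans V W (fun=> 0) nt_zero_subproof.

Fact nt_opp_subproof (f : nattrans V W) (l m : L) (h : l <= m) :
  (- f m) ∘ fmap V h = fmap W h ∘ (- f l).
Proof. by rewrite compNm compmN nt_natural. Qed.

Definition nt_opp (f : nattrans V W) : nattrans V W :=
  @NatTrans V W (fun l => - f l) (nt_opp_subproof f).

Fact nt_add_subproof (f g : nattrans V W) (l m : L) (h : l <= m) :
  (f m + g m) ∘ fmap V h = fmap W h ∘ (f l + g l).
Proof. by rewrite compmDl compmDr !nt_natural. Qed.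

Definition nt_add (f g : nattrans V W) : nattrans V W :=
  @NatTrans V W (fun l => f l + g l) (nt_add_subproof f g).

Fact nt_addA : associative nt_add.
Proof. by move=> f g h; apply: nattrans_ext => l /=; rewrite addrA. Qed.

Fact nt_addC : commutative nt_add.
Proof. by move=> f g; apply: nattrans_ext => l /=; rewrite addrC. Qed.

Fact nt_add0 : left_id nt_zero nt_add.
Proof. by move=> f; apply: nattrans_ext => l /=; rewrite add0r. Qed.

Fact nt_addN : left_inverse nt_zero nt_opp nt_add.
Proof. by move=> f; apply: nattrans_ext => l /=; rewrite addNr. Qed.

HB.instance Definition _ := gen_eqMixin (nattrans V W).
HB.instance Definition _ := gen_choiceMixin (nattrans V W).
HB.instance Definition _ :=
  GRing.isZmodule.Build (nattrans V W) nt_addA nt_addC nt_add0 nt_addN.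

End NatTransZmodule.

Fact nt_id_subproof (V : lfunctor) (l m : L) (h : l <= m) :
  idm (V m) ∘ fmap V h = fmap V h ∘ idm (V l).
Proof. by rewrite comp1m compm1. Qed.

Definition nt_id (V : lfunctor) : nattrans V V :=
  @NatTrans V V (fun l => idm (V l)) (@nt_id_subproof V).

Fact nt_comp_subproof (U V W : lfunctor) (g : nattrans V W) (f : nattrans U V)
    (l m : L) (h : l <= m) :
  (g m ∘ f m) ∘ fmap U h = fmap W h ∘ (g l ∘ f l).
Proof. by rewrite -compmA nt_natural !compmA nt_natural. Qed.

Definition nt_comp (U V W : lfunctor) (g : nattrans V W) (f : nattrans U V) :
    nattrans U W :=
  @NatTrans U W (fun l => g l ∘ f l) (nt_comp_subproof g f).

Definition Fun : preadditive.
Proof.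
refine {| ob := lfunctor; Mor := nattrans; idm := nt_id; compm := nt_comp |};
  intros; apply: nattrans_ext => l /=.
- exact: comp1m.
- exact: compm1.
- exact: compmA.
- exact: compmDl.
- exact: compmDr.
Defined.

(* Cocones and colimits of the restriction of W to a subset D of L. *)
Definition is_cocone (W : lfunctor) (D : pred L) (X : A)
    (c : forall l : L, D l -> Mor (W l) X) : Prop :=
  forall (l m : L) (h : l <= m) (Dl : D l) (Dm : D m), c m Dm ∘ fmap W h = c l Dl.

Definition is_colim (W : lfunctor) (D : pred L) (X : A)
    (c : forall l : L, D l -> Mor (W l) X) : Prop :=
  is_cocone c /\
  forall (Y : A) (d : forall l : L, D l -> Mor (W l) Y), is_cocone d ->
    exists! u : Mor X Y, forall (l : L) (Dl : D l), u ∘ c l Dl = d l Dl.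

(* The list s holds the breaks. For s = [::] the conditions before the first
   break and after the last one both apply to every index, forcing M = 0. *)
Definition is_filtration (W : lfunctor) : Prop :=
  exists (M : A) (c : forall l : L, predT l -> Mor (W l) M),
    [/\ is_colim c,
        (forall l : L, is_monic (c l isT) /\ is_strict (c l isT))
      & exists s : seq L,
        [/\ sorted <%R s,
            (forall l : L, all (fun b => l < b) s -> is_zero (W l)),
            (forall (i : nat) (l : L) (h : s`_i <= l),
               (i.+1 < size s)%N -> l < s`_i.+1 -> is_iso (fmap W h))
          & (forall l : L, all (fun b => b <= l) s -> is_iso (c l isT))]].

Definition Wpre : preadditive := @full_sub Fun is_filtration.

(* G is the graded piece gr_l of W: the cokernel of the canonical morphism j
   from the colimit V of the W m, m < l, to W l. *)
Definition is_gr (W : lfunctor) (l : L) (G : A) : Prop :=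
  exists (V : A) (c : forall m : L, m < l -> Mor (W m) V)
         (j : Mor V (W l)) (q : Mor (W l) G),
    [/\ @is_colim W (fun m => m < l) V c,
        (forall (m : L) (h : m < l), j ∘ c m h = fmap W (ltW h))
      & is_coker j q].

End Functors.

Section Slopes.
Variables (L : porderZmodType) (A : preadditive).

Definition ordered_group : Prop :=
  total (<=%R : rel L) /\ (forall x y z : L, x <= y -> x + z <= y + z).

Definition uniquely_divisible : Prop :=
  forall (n : nat) (x : L), (0 < n)%N -> exists! y : L, y *+ n = x.

Definition is_rank (rk : A -> nat) : Prop :=
  [/\ (forall M N, isomorphic M N -> rk M = rk N),
      (forall M N P (f : Mor M N) (g : Mor N P),
         short_exact f g -> rk N = (rk M + rk P)%N)
    & (forall M, ~ is_zero M -> rk M <> 0%N)].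

Definition is_degree (deg : A -> L) : Prop :=
  (forall M N, isomorphic M N -> deg M = deg N) /\
  (forall M N P (f : Mor M N) (g : Mor N P),
     short_exact f g -> deg N = deg M + deg P).

(* deg M / rk M in the uniquely divisible group L; the value at a zero object
   is irrelevant. *)
Definition slope (rk : A -> nat) (deg : A -> L) (M : A) : L :=
  xget 0 [set y : L | y *+ rk M = deg M]%classic.

Definition is_slope_function (mu : A -> L) : Prop :=
  forall (M N : A) (phi : Mor M N),
    ~ is_zero M -> ~ is_zero N -> is_monic phi -> is_epi phi ->
    mu M <= mu N /\ (mu M = mu N <-> is_iso phi).

Variable mu : A -> L.

Definition semistable (M : A) : Prop :=
  ~ is_zero M /\
  forall (N : A) (i : Mor N M), ~ is_zero N -> is_monic i -> mu N <= mu M.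

Definition in_slope (l : L) (M : A) : Prop :=
  is_zero M \/ (semistable M /\ mu M = l).

(* Graded pieces are unique up to isomorphism, so the choice of G in the next
   three definitions does not matter. *)
Definition in_W (M : Wpre L A) : Prop :=
  forall l : L, exists G : A, is_gr (sval M) l G /\ in_slope l G.

Definition in_Wuds (M : Wpre L A) : Prop :=
  forall l : L, exists G : A, is_gr (sval M) l G /\
    forall (N : A) (i : Mor N G), ~ is_zero N -> is_monic i -> mu N <= l.

Definition in_Wudq (M : Wpre L A) : Prop :=
  forall l : L, exists G : A, is_gr (sval M) l G /\
    forall (N : A) (p : Mor G N), ~ is_zero N -> is_epi p -> l <= mu N.

End Slopes.

(* Main.v *)
(* A morphism X -> Y with all quotients of X of slope >= l and all subobjects of
   Y of slope <= m vanishes if m < l; if m = l it is strict, its image is zero or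
   semistable of slope l, its kernel again has quotients of slope >= l and its
   cokernel subobjects of slope <= l. Climbing up the breaks, let f', f, f'' be
   the maps induced by f on W_{<l}, W_{<=l} and gr_l. The snake map
   Ker f'' -> Coker f' vanishes by slopes, so that strictness of f' and f''
   passes to f, the images of f', f, f'' form a short exact sequence, and
   0 -> Coker f' -> Coker f -> Coker f'' is exact.
   Hence kernel, image and cokernel of f can be formed level by level, and
   gr_l of the image is the image of gr_l f. *)
Require Import Defs.
From mathcomp Require Import all_boot all_order all_algebra.
From mathcomp Require Import boolp classical_sets.

Set Implicit Arguments.
Unset Strict Implicit.
Unset Printing Implicit Defensive.

Import Order.TTheory GRing.Theory.
Local Open Scope ring_scope.

(** * Preadditive categories *)

(** The obstacle is the cokernel. Kernels in [Wpre] are formed pointwise, but the pointwise cokernel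
    of a general morphism is no filtration, as its transition maps need not even be monic. So
    everything hinges on Coker f' -> Coker f being a strict monic. The slope axiom acts through Coim
    -> Im, which is monic and epi in a quasi-abelian category. For a nonzero coimage this gives l <=
    mu(Coim) <= mu(Im) <= m, which is impossible for m < l; for m = l equality holds throughout, and
    the equality case of the axiom makes Coim -> Im an isomorphism. The snake map vanishes because
    Coker f' is built from cokernels of lower graded maps. The induction carries the vanishing of
    morphisms into Coker f' rather than a bound on its slopes, since vanishing passes along a left
    exact sequence at once. *)

Section Preadditive.
Variable A : preadditive.
Implicit Types M N P Q X Y Z K : A.

Lemma compmBr M N P (g : Mor N P) (f f' : Mor M N) :
  g ∘ (f - f') = g ∘ f - g ∘ f'.
Proof. by rewrite compmDr compmN. Qed.

Lemma compmBl M N P (g g' : Mor N P) (f : Mor M N) :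
  (g - g') ∘ f = g ∘ f - g' ∘ f.
Proof. by rewrite compmDl compNm. Qed.

Lemma monicP M N (f : Mor M N) :
  is_monic f <-> forall X (g : Mor X M), f ∘ g = 0 -> g = 0.
Proof.
split=> [mf X g fg0|mf X g h fgh]; first by apply: mf; rewrite compm0.
by apply/eqP; rewrite -subr_eq0; apply/eqP/mf; rewrite compmBr fgh subrr.
Qed.

Lemma epiP M N (f : Mor M N) :
  is_epi f <-> forall X (g : Mor N X), g ∘ f = 0 -> g = 0.
Proof.
split=> [ef X g gf0|ef X g h fgh]; first by apply: ef; rewrite comp0m.
by apply/eqP; rewrite -subr_eq0; apply/eqP/ef; rewrite compmBl fgh subrr.
Qed.

Lemma is_zeroP Z : is_zero Z <-> idm Z = 0.
Proof.
split=> [zZ|Z0 X]; first exact: (zZ Z).1.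
by split=> f; [rewrite -[f]compm1 Z0 compm0|rewrite -[f]comp1m Z0 comp0m].
Qed.

Lemma zero_from Z X (f : Mor Z X) : is_zero Z -> f = 0.
Proof. by move=> zZ; apply: (zZ X).1. Qed.

Lemma zero_to Z X (f : Mor X Z) : is_zero Z -> f = 0.
Proof. by move=> zZ; apply: (zZ X).2. Qed.

Lemma zero_monic M N (f : Mor M N) : is_monic f -> is_zero N -> is_zero M.
Proof.
move=> mf zN; apply/is_zeroP/mf.
by rewrite (zero_to (f ∘ _) zN) compm0.
Qed.

Lemma zero_epi M N (f : Mor M N) : is_epi f -> is_zero M -> is_zero N.
Proof.
move=> ef zM; apply/is_zeroP/ef.
by rewrite (zero_from (_ ∘ f) zM) comp0m.
Qed.

Lemma monic_comp M N P (g : Mor N P) (f : Mor M N) :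
  is_monic g -> is_monic f -> is_monic (g ∘ f).
Proof. by move=> mg mf X a b; rewrite -!compmA => /mg/mf. Qed.

Lemma epi_comp M N P (g : Mor N P) (f : Mor M N) :
  is_epi g -> is_epi f -> is_epi (g ∘ f).
Proof. by move=> eg ef X a b; rewrite !compmA => /ef/eg. Qed.

Lemma is_kerI M N (f : Mor M N) K (k : Mor K M) :
  f ∘ k = 0 -> is_monic k ->
  (forall X (g : Mor X M), f ∘ g = 0 -> exists u : Mor X K, k ∘ u = g) ->
  is_ker f k.
Proof.
move=> fk mk lift; split=> // X g /lift [u ku]; exists u; split=> // v kv.
by apply: mk; rewrite ku kv.
Qed.

Lemma is_cokerI M N (f : Mor M N) Q (q : Mor N Q) :
  q ∘ f = 0 -> is_epi q ->
  (forall X (g : Mor N X), g ∘ f = 0 -> exists u : Mor Q X, u ∘ q = g) ->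
  is_coker f q.
Proof.
move=> qf eq lift; split=> // X g /lift [u uq]; exists u; split=> // v vq.
by apply: eq; rewrite uq vq.
Qed.

Lemma ker_lift M N (f : Mor M N) K (k : Mor K M) X (g : Mor X M) :
  is_ker f k -> f ∘ g = 0 -> exists u : Mor X K, k ∘ u = g.
Proof. by move=> [_ lift] /lift [u [ku _]]; exists u. Qed.

Lemma coker_lift M N (f : Mor M N) Q (q : Mor N Q) X (g : Mor N X) :
  is_coker f q -> g ∘ f = 0 -> exists u : Mor Q X, u ∘ q = g.
Proof. by move=> [_ lift] /lift [u [ku _]]; exists u. Qed.

Lemma ker_monic M N (f : Mor M N) K (k : Mor K M) : is_ker f k -> is_monic k.
Proof.
move=> [fk lift] X g h kgh.
have [|u [_ uniq]] := lift X (k ∘ g); first by rewrite compmA fk comp0m.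
by rewrite -(uniq g) // -(uniq h).
Qed.

Lemma coker_epi M N (f : Mor M N) Q (q : Mor N Q) : is_coker f q -> is_epi q.
Proof.
move=> [qf lift] X g h gqh.
have [|u [_ uniq]] := lift X (g ∘ q); first by rewrite -compmA qf compm0.
by rewrite -(uniq g) // -(uniq h).
Qed.

Lemma kernel_map_monic M N (f : Mor M N) : is_kernel_map f -> is_monic f.
Proof. by move=> [P [g /ker_monic]]. Qed.

Lemma cokernel_map_epi M N (f : Mor M N) : is_cokernel_map f -> is_epi f.
Proof. by move=> [P [g /coker_epi]]. Qed.

(** The morphism whose cokernel is [q] factors through [k], so whatever kills [k] kills it too. *)
Lemma coker_of_ker M N (q : Mor M N) K (k : Mor K M) :
  is_cokernel_map q -> is_ker q k -> is_coker k q.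
Proof.
move=> [P [f cq]] kq; apply: is_cokerI; [exact: kq.1|exact: coker_epi cq|].
move=> X g gk; apply: (coker_lift cq).
by have [u <-] := ker_lift kq cq.1; rewrite compmA gk comp0m.
Qed.

Lemma ker_of_coker M N (k : Mor M N) Q (q : Mor N Q) :
  is_kernel_map k -> is_coker k q -> is_ker q k.
Proof.
move=> [P [f kk]] cq; apply: is_kerI; [exact: cq.1|exact: ker_monic kk|].
move=> X g qg; apply: (ker_lift kk).
by have [u <-] := coker_lift cq kk.1; rewrite -compmA qg compm0.
Qed.

Lemma ker_monic_comp M N P (g : Mor N P) (f : Mor M N) K (k : Mor K M) :
  is_monic g -> is_ker (g ∘ f) k <-> is_ker f k.
Proof.
move=> mg; have E X (x : Mor X M) : g ∘ f ∘ x = 0 <-> f ∘ x = 0.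
  rewrite -compmA; split=> [gfx|->]; last exact: compm0.
  by apply: mg; rewrite compm0.
by split=> -[/E fk lift]; split=> // X x /E /lift.
Qed.

Lemma coker_epi_comp M N P (g : Mor N P) (f : Mor M N) Q (q : Mor P Q) :
  is_epi f -> is_coker (g ∘ f) q <-> is_coker g q.
Proof.
move=> ef; have E X (x : Mor P X) : x ∘ (g ∘ f) = 0 <-> x ∘ g = 0.
  rewrite compmA; split=> [gfx|->]; last exact: comp0m.
  by apply: ef; rewrite comp0m.
by split=> -[/E fk lift]; split=> // X x /E /lift.
Qed.

Lemma ker_unique M N (f : Mor M N) K (k : Mor K M) K' (k' : Mor K' M) :
  is_ker f k -> is_ker f k' -> exists2 u : Mor K K', is_iso u & k' ∘ u = k.
Proof.
move=> kk kk'; have [u ku] := ker_lift kk' kk.1.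
have [v kv] := ker_lift kk kk'.1; exists u => //; exists v.
split; [apply: (ker_monic kk)|apply: (ker_monic kk')].
  by rewrite compmA kv ku compm1.
by rewrite compmA ku kv compm1.
Qed.

Lemma coker_unique M N (f : Mor M N) Q (q : Mor N Q) Q' (q' : Mor N Q') :
  is_coker f q -> is_coker f q' -> exists2 u : Mor Q Q', is_iso u & u ∘ q = q'.
Proof.
move=> kk kk'; have [u ku] := coker_lift kk kk'.1.
have [v kv] := coker_lift kk' kk.1; exists u => //; exists v.
split; [apply: (coker_epi kk)|apply: (coker_epi kk')].
  by rewrite -compmA ku kv comp1m.
by rewrite -compmA kv ku comp1m.
Qed.

Lemma iso_monic M N (f : Mor M N) : is_iso f -> is_monic f.
Proof.
by move=> [g [gf _]] X a b fab; rewrite -[a]comp1m -[b]comp1m -gf -!compmA fab.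
Qed.

Lemma iso_epi M N (f : Mor M N) : is_iso f -> is_epi f.
Proof.
by move=> [g [_ fg]] X a b fab; rewrite -[a]compm1 -[b]compm1 -fg !compmA fab.
Qed.

Lemma iso_comp M N P (g : Mor N P) (f : Mor M N) :
  is_iso g -> is_iso f -> is_iso (g ∘ f).
Proof.
move=> [g' [g'g gg']] [f' [f'f ff']]; exists (f' ∘ g'); split.
  by rewrite -compmA [g' ∘ _]compmA g'g comp1m.
by rewrite -compmA [f ∘ _]compmA ff' comp1m.
Qed.

Lemma iso_id M : is_iso (idm M).
Proof. by exists (idm M); rewrite comp1m. Qed.

Lemma iso_cancel_right M N P (g : Mor N P) (f : Mor M N) :
  is_iso (g ∘ f) -> is_iso f -> is_iso g.
Proof.
move=> igf [f' [f'f ff']].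
suff -> : g = (g ∘ f) ∘ f' by apply: iso_comp => //; exists f.
by rewrite -compmA ff' compm1.
Qed.

Lemma iso_cancel_left M N P (g : Mor N P) (f : Mor M N) :
  is_iso (g ∘ f) -> is_iso g -> is_iso f.
Proof.
move=> igf [g' [g'g gg']].
suff -> : f = g' ∘ (g ∘ f) by apply: iso_comp => //; exists g.
by rewrite compmA g'g comp1m.
Qed.

Lemma iso_zero M N (f : Mor M N) : is_zero M -> is_zero N -> is_iso f.
Proof.
by move=> zM zN; exists 0; split; [rewrite [LHS](zero_from _ zM) (zero_from (idm M) zM)|
  rewrite [LHS](zero_from _ zN) (zero_from (idm N) zN)].
Qed.

Lemma iso_coker M N Q (q : Mor N Q) (f : Mor M N) (z : f = 0) :
  is_iso q -> is_coker f q.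
Proof.
move=> iq; apply: is_cokerI; [by rewrite z compm0|exact: iso_epi|].
have [r [rq _]] := iq.
by move=> X g _; exists (g ∘ r); rewrite -compmA rq compm1.
Qed.

Lemma ker_comp_iso M N (f : Mor M N) K (k : Mor K M) K' (u : Mor K' K) :
  is_ker f k -> is_iso u -> is_ker f (k ∘ u).
Proof.
move=> kk iu; apply: is_kerI.
- by rewrite compmA kk.1 comp0m.
- exact: monic_comp (ker_monic kk) (iso_monic iu).
move=> X g /(ker_lift kk) [v <-]; have [u' [_ uu']] := iu.
by exists (u' ∘ v); rewrite -compmA [u ∘ _]compmA uu' comp1m.
Qed.

Lemma coker_comp_iso M N (f : Mor M N) Q (q : Mor N Q) Q' (u : Mor Q Q') :
  is_coker f q -> is_iso u -> is_coker f (u ∘ q).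
Proof.
move=> kk iu; apply: is_cokerI.
- by rewrite -compmA kk.1 compm0.
- exact: epi_comp (iso_epi iu) (coker_epi kk).
move=> X g /(coker_lift kk) [v <-]; have [u' [u'u _]] := iu.
by exists (v ∘ u'); rewrite -compmA [u' ∘ _]compmA u'u comp1m.
Qed.

Lemma kernel_map_comp_iso K M K' (k : Mor K M) (u : Mor K' K) :
  is_kernel_map k -> is_iso u -> is_kernel_map (k ∘ u).
Proof. by move=> [N [f kk]] iu; exists N, f; apply: ker_comp_iso. Qed.

Lemma cokernel_map_comp_iso N Q Q' (q : Mor N Q) (u : Mor Q Q') :
  is_cokernel_map q -> is_iso u -> is_cokernel_map (u ∘ q).
Proof. by move=> [M [f cq]] iu; exists M, f; apply: coker_comp_iso. Qed.

Lemma idm_kernel_map M : is_kernel_map (idm M).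
Proof.
exists M, 0; apply: is_kerI; [exact: comp0m|exact/iso_monic/iso_id|].
by move=> X g _; exists g; rewrite comp1m.
Qed.

Lemma idm_cokernel_map M : is_cokernel_map (idm M).
Proof.
exists M, 0; apply: is_cokerI; [exact: compm0|exact/iso_epi/iso_id|].
by move=> X g _; exists g; rewrite compm1.
Qed.

Lemma zero_kernel_map Z M (f : Mor Z M) : is_zero Z -> is_kernel_map f.
Proof.
move=> zZ; exists M, (idm M); apply: is_kerI.
- exact: zero_from.
- by move=> X g h _; rewrite (zero_to g zZ) (zero_to h zZ).
by move=> X g; rewrite comp1m => ->; exists 0; rewrite compm0.
Qed.

Lemma kernel_map_cancel M N P (g : Mor N P) (f : Mor M N) :
  is_monic g -> is_kernel_map (g ∘ f) -> is_kernel_map f.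
Proof.
move=> mg [Q [h [hgf lift]]]; exists Q, (h ∘ g); apply: is_kerI.
- by rewrite -compmA.
- apply/monicP => X x fx.
  apply: (ker_monic (conj hgf lift)).
  by rewrite compm0 -compmA fx compm0.
move=> X x; rewrite -compmA => /lift [u [gfu _]].
by exists u; apply: mg; rewrite compmA.
Qed.

(** The kernel of a monic is 0, so its coimage projection is a cokernel of 0 and hence
    invertible. *)
Lemma strict_monic_kernel_map M N (f : Mor M N) :
  is_monic f -> is_strict f -> is_kernel_map f.
Proof.
move=> mf [P [p [Q [i [u [[K [k [kk cp]]] [T [q [_ ki]]] <- iu]]]]]].
have k0 : k = 0 by apply: mf; rewrite kk.1 compm0.
rewrite -compmA; apply: kernel_map_comp_iso; first by exists T, q.
apply: iso_comp => //; have [|v vp] := coker_lift (g := idm M) cp.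
  by rewrite k0 compm0.
exists v; split=> //; apply: (coker_epi cp).
by rewrite -compmA vp compm1 comp1m.
Qed.

Lemma kernel_map_strict M N (f : Mor M N) :
  has_kernels A -> has_cokernels A -> is_kernel_map f -> is_strict f.
Proof.
move=> hk hc kf; have [Q [q cq]] := hc _ _ f; have [K [k kk]] := hk _ _ f.
have k0 : k = 0 by apply: (kernel_map_monic kf); rewrite kk.1 compm0.
exists M, (idm M), M, f, (idm M); split.
- by exists K, k; split=> //; apply: (iso_coker k0); apply: iso_id.
- by exists Q, q; split=> //; apply: ker_of_coker.
- by rewrite !compm1.
- exact: iso_id.
Qed.

End Preadditive.

(** * Quasi-abelian categories *)

(** Kernels and pullbacks here unfold to cokernels and pushouts of [A], so a dual lemma is an
    instance with the objects in reverse order. *)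
Definition opposite (A : preadditive) : preadditive := {|
  ob := A;
  Mor := fun M N => @Mor A N M;
  idm := @idm A;
  compm := fun M N P g f => f ∘ g;
  comp1m := fun M N f => compm1 f;
  compm1 := fun M N f => comp1m f;
  compmA := fun M N P Q h g f => esym (compmA f g h);
  compmDl := fun M N P g g' f => compmDr f g g';
  compmDr := fun M N P g f f' => compmDl f f' g |}.

Lemma opposite_quasi_abelian (A : preadditive) :
  quasi_abelian A -> quasi_abelian (opposite A).
Proof.
move=> [[[Z zZ] bip] hk hc po pb]; split.
- split; first by exists Z => X; split=> f; [apply: (zZ X).2|apply: (zZ X).1].
  move=> M N; have [P [i [j [p [q [pi qj qi pj s]]]]]] := bip M N.
  by exists P, p, q, i, j.
- by move=> M N f; apply: hc.
- by move=> M N f; apply: hk.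
- by move=> M N P Q f g f' g'; apply: (pb N M P Q f g f' g').
- by move=> M N P Q f g f' g'; apply: (po N M P Q f g f' g').
Qed.

Section QuasiAbelian.
Variable A : preadditive.
Hypothesis qA : quasi_abelian A.
Implicit Types M N P Q X Y Z K : A.

Lemma exists_zero : exists Z : A, is_zero Z.
Proof. by case: qA => -[]. Qed.

Lemma exists_ker M N (f : Mor M N) : exists K (k : Mor K M), is_ker f k.
Proof. by case: qA. Qed.

Lemma exists_coker M N (f : Mor M N) : exists Q (q : Mor N Q), is_coker f q.
Proof. by case: qA. Qed.

Lemma exists_pullback M N P (f : Mor M N) (g : Mor P N) :
  exists Q (f' : Mor Q P) (g' : Mor Q M), is_pullback f g f' g'.
Proof.
have [[_ bip] _ _ _ _] := qA.
have [B [i [j [p [q [pi qj qi pj s]]]]]] := bip M P.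
have [K [k kk]] := exists_ker (f ∘ p - g ∘ q).
exists K, (q ∘ k), (p ∘ k); split.
  by apply/eqP; rewrite -subr_eq0 !compmA -compmBl kk.1.
move=> X a b fab; have [|u ku] := ker_lift (g := i ∘ a + j ∘ b) kk.
  rewrite compmBl !compmDr -!compmA ![p ∘ (_ ∘ _)]compmA ![q ∘ (_ ∘ _)]compmA.
  by rewrite pi pj qi qj !comp1m !comp0m !compm0 addr0 add0r fab subrr.
exists u; split=> [|v [pv qv]].
  rewrite -!compmA ku !compmDr !compmA.
  by rewrite pi pj qi qj !comp1m !comp0m addr0 add0r.
apply: (ker_monic kk); rewrite ku -[k ∘ v]comp1m -s compmDl.
by rewrite -!compmA -pv -qv !compmA.
Qed.

(** A generalized element [g] of N lifts along [f] after the cover [pi]; this replaces the choice of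
    preimages in the chases below. *)
Lemma cokernel_map_pull M N P (f : Mor M N) (g : Mor P N) :
  is_cokernel_map f ->
  exists Q (pi : Mor Q P) (y : Mor Q M), is_cokernel_map pi /\ f ∘ y = g ∘ pi.
Proof.
move=> cf; have [Q [f' [g' pb]]] := exists_pullback f g.
exists Q, f', g'; split; last exact: pb.1.
by case: qA => _ _ _ _; apply; [exact: pb|].
Qed.

Lemma cokernel_map_comp M N P (g : Mor N P) (f : Mor M N) :
  is_cokernel_map g -> is_cokernel_map f -> is_cokernel_map (g ∘ f).
Proof.
move=> cg cf; have [K [k kk]] := exists_ker (g ∘ f); exists K, k.
apply: is_cokerI; first exact: kk.1.
  by apply: epi_comp; apply: cokernel_map_epi.
move=> X t tk; have [Kf [kf kkf]] := exists_ker f.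
have [|s sf] := coker_lift (g := t) (coker_of_ker cf kkf).
  have [|u <-] := ker_lift (g := kf) kk; last by rewrite compmA tk comp0m.
  by rewrite -compmA kkf.1 compm0.
have [Kg [kg kkg]] := exists_ker g.
have [|r rg] := coker_lift (g := s) (coker_of_ker cg kkg); last first.
  by exists r; rewrite compmA rg.
(* [s] kills ker g: after a cover, elements of ker g lift along [f] to elements of ker (g f), which
   [t] kills. *)
have [Y [pi [y [cpi fy]]]] := cokernel_map_pull kg cf.
apply: (cokernel_map_epi cpi); rewrite comp0m -compmA -fy compmA sf.
have [|u <-] := ker_lift (g := y) kk; last by rewrite compmA tk comp0m.
by rewrite -compmA fy compmA kkg.1 comp0m.
Qed.

(* The pairs (y, x) with g y = g f x cover Y, and y - f x lies in ker g. *)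
Lemma cokernel_map_cancel X Y Z (g : Mor Y Z) (f : Mor X Y) :
  is_cokernel_map (g ∘ f) -> is_cokernel_map g.
Proof.
move=> cgf; have [K [k kk]] := exists_ker g; exists K, k.
apply: is_cokerI; first exact: kk.1.
  apply/epiP => T t tg; apply: (cokernel_map_epi cgf).
  by rewrite comp0m compmA tg comp0m.
move=> T h hk; have [K' [k' kk']] := exists_ker (g ∘ f).
have [|v vgf] := coker_lift (g := h ∘ f) (coker_of_ker cgf kk').
  rewrite -compmA; have [|u <-] := ker_lift (g := f ∘ k') kk.
    by rewrite compmA kk'.1.
  by rewrite compmA hk comp0m.
have [P [py [px [cpy e]]]] := cokernel_map_pull g cgf.
exists v; apply: (cokernel_map_epi cpy).
rewrite -compmA -e compmA vgf.
have [|u ku] := ker_lift (g := py - f ∘ px) kk.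
  by rewrite compmBr compmA e subrr.
apply/esym/eqP; rewrite -subr_eq0 -compmA -compmBr -ku.
by rewrite compmA hk comp0m.
Qed.

(* Being a kernel may be tested after precomposition with cokernel maps, which
   play the role of covers in the diagram chases below. *)
Lemma ker_local M N P (j : Mor M N) (t : Mor N P) :
  is_monic j -> t ∘ j = 0 ->
  (forall X (x : Mor X N), t ∘ x = 0 ->
     exists X' (pi : Mor X' X) (y : Mor X' M),
       is_cokernel_map pi /\ j ∘ y = x ∘ pi) ->
  is_ker t j.
Proof.
move=> mj tj loc; apply: is_kerI => // X x /loc [X' [pi [y [cpi jy]]]].
have [K [k kk]] := exists_ker pi.
have [|u uy] := coker_lift (g := y) (coker_of_ker cpi kk).
  by apply: mj; rewrite compm0 compmA jy -compmA kk.1 compm0.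
by exists u; apply: (cokernel_map_epi cpi); rewrite -compmA uy jy.
Qed.

(** After a cover, an element of P killed by [h] lifts to an element of ker f, and [p] kills
    that. *)
Lemma coim_monic M N (f : Mor M N) K (k : Mor K M) P (p : Mor M P)
    (h : Mor P N) :
  is_ker f k -> is_coker k p -> h ∘ p = f -> is_monic h.
Proof.
move=> kk cp hp; apply/monicP => X y hy.
have [|X' [pi [x [cpi px]]]] := cokernel_map_pull y (f := p).
  by exists K, k.
have [|u ku] := ker_lift (g := x) kk; first by rewrite -hp -compmA px compmA hy comp0m.
by apply: (cokernel_map_epi cpi); rewrite -px -ku compmA cp.1 !comp0m.
Qed.

End QuasiAbelian.

Section Dual.
Variable A : preadditive.
Hypothesis qA : quasi_abelian A.
Let qA' := opposite_quasi_abelian qA.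
Implicit Types M N P Q X Y Z K : A.

Lemma exists_pushout M N P (f : Mor M N) (g : Mor M P) :
  exists Q (f' : Mor P Q) (g' : Mor N Q), is_pushout f g f' g'.
Proof. exact: (@exists_pullback (opposite A) qA' N M P f g). Qed.

Lemma kernel_map_comp M N P (g : Mor N P) (f : Mor M N) :
  is_kernel_map g -> is_kernel_map f -> is_kernel_map (g ∘ f).
Proof. by move=> kg kf; apply: (@cokernel_map_comp (opposite A) qA' P N M f g). Qed.

(** Unlike in [kernel_map_cancel], [g] need not be monic: a map into an extension is recognized as a
    kernel by its composite to the quotient. *)
Lemma kernel_map_cancel_right X Y Z (g : Mor Y Z) (f : Mor X Y) :
  is_kernel_map (g ∘ f) -> is_kernel_map f.
Proof. exact: (@cokernel_map_cancel (opposite A) qA' Z Y X f g). Qed.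

Lemma im_epi M N (f : Mor M N) Q (q : Mor N Q) I (i : Mor I N)
    (h : Mor M I) :
  is_coker f q -> is_ker q i -> i ∘ h = f -> is_epi h.
Proof. exact: (@coim_monic (opposite A) qA' N M f Q q I i h). Qed.

End Dual.

(** In a quasi-abelian category this amounts to [is_strict], without naming a kernel or cokernel of
    [f]. *)
Definition admissible (A : preadditive) (M N : A) (f : Mor M N) : Prop :=
  exists (C : A) (p : Mor M C) (i : Mor C N),
    [/\ is_cokernel_map p, is_kernel_map i & f = i ∘ p].

Section Admissible.
Variable A : preadditive.
Implicit Types M N P Q X Y Z K C : A.

Lemma im_of_factor M N C (f : Mor M N) (p : Mor M C) (i : Mor C N)
    Q (q : Mor N Q) :
  is_epi p -> is_kernel_map i -> f = i ∘ p -> is_coker f q -> is_ker q i.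
Proof. by move=> ep ki ->; rewrite coker_epi_comp //; apply: ker_of_coker. Qed.

Lemma coim_of_factor M N C (f : Mor M N) (p : Mor M C) (i : Mor C N)
    K (k : Mor K M) :
  is_cokernel_map p -> is_monic i -> f = i ∘ p -> is_ker f k -> is_coker k p.
Proof. by move=> cp mi ->; rewrite ker_monic_comp //; apply: coker_of_ker. Qed.

(** Images are unique up to isomorphism, so [p] is the first factor of an admissible factorization
    followed by an isomorphism. *)
Lemma admissible_coim M N C (f : Mor M N) (p : Mor M C) (i : Mor C N)
    Q (q : Mor N Q) :
  admissible f -> is_coker f q -> is_ker q i -> f = i ∘ p ->
  is_cokernel_map p.
Proof.
move=> [C0 [p0 [i0 [cp0 ki0 f0]]]] cq ki fip.
have ki0q := im_of_factor (cokernel_map_epi cp0) ki0 f0 cq.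
have [u iu iu0] := ker_unique ki0q ki.
suff -> : p = u ∘ p0 by apply: cokernel_map_comp_iso.
by apply: (ker_monic ki); rewrite -fip f0 compmA iu0.
Qed.

Lemma zero_admissible Z M (f : Mor Z M) :
  is_zero Z -> admissible f.
Proof.
move=> zZ; exists Z, (idm Z), f; split; last by rewrite compm1.
  exact: idm_cokernel_map.
exact: zero_kernel_map.
Qed.

End Admissible.

(** * Extensions under pushout and pullback *)

Section Extension.
Variable A : preadditive.
Hypothesis qA : quasi_abelian A.

(** The quotient of the extension survives: [w] is glued from [b] on M and 0 on X, and stability of
    kernels makes [s] a kernel. *)
Lemma pushout_short_exact (M' M M'' X P : A) (a : Mor M' M) (b : Mor M M'')
    (g : Mor M' X) (s : Mor X P) (r : Mor M P) :
  short_exact a b -> is_pushout a g s r ->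
  exists2 w : Mor P M'', w ∘ r = b & short_exact s w.
Proof.
move=> [ka cb] po; have [ra lift] := po.
have ks : is_kernel_map s.
  by case: qA => _ _ _ st _; apply: (st _ _ _ _ _ _ _ _ po); exists M'', b.
have [w [[wr ws] _]] : exists! w : Mor P M'', w ∘ r = b /\ w ∘ s = 0.
  by apply: lift; rewrite comp0m ka.1.
exists w => //; suff cw : is_coker s w by split=> //; apply: ker_of_coker.
apply: is_cokerI => //.
  apply/epiP => Y t tw; apply: (coker_epi cb).
  by rewrite comp0m -wr compmA tw comp0m.
move=> Y t ts; have [|u ub] := coker_lift (g := t ∘ r) cb.
  by rewrite -compmA ra compmA ts comp0m.
exists u; have [z [_ uz]] : exists! z : Mor P Y, z ∘ r = u ∘ b /\ z ∘ s = 0.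
  by apply: lift; rewrite comp0m -compmA ka.1 compm0.
rewrite -(uz t) // -(uz (u ∘ w)) //.
by rewrite -!compmA wr ws compm0.
Qed.

Lemma pushout_epi (M N P Q : A) (f : Mor M N) (g : Mor M P)
    (f' : Mor P Q) (g' : Mor N Q) :
  is_pushout f g f' g' -> is_epi g -> is_epi g'.
Proof.
move=> [gf lift] eg; apply/epiP => X t tg.
have tf : t ∘ f' = 0 by apply: eg; rewrite comp0m -compmA -gf compmA tg comp0m.
have [z [_ uz]] : exists! z : Mor Q X, z ∘ g' = 0 /\ z ∘ f' = 0.
  by apply: lift; rewrite !comp0m.
by rewrite -(uz t) // -(uz 0) // !comp0m.
Qed.

End Extension.

Section ExtensionDual.
Variable A : preadditive.
Hypothesis qA : quasi_abelian A.

Lemma pullback_short_exact (M' M M'' X P : A) (a : Mor M' M) (b : Mor M M'')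
    (g : Mor X M'') (s : Mor P X) (r : Mor P M) :
  short_exact a b -> is_pullback b g s r ->
  exists2 w : Mor M' P, r ∘ w = a & short_exact w s.
Proof.
move=> [ka cb] pb.
have [w rw [cs kw]] := @pushout_short_exact (opposite A)
  (opposite_quasi_abelian qA) M'' M M' X P b a g s r (conj cb ka) pb.
by exists w.
Qed.

Lemma pullback_monic (M N P Q : A) (f : Mor M N) (g : Mor P N)
    (f' : Mor Q P) (g' : Mor Q M) :
  is_pullback f g f' g' -> is_monic g -> is_monic g'.
Proof. exact: (@pushout_epi (opposite A) N M P Q f g f' g'). Qed.

End ExtensionDual.

(** * The snake lemma for strict morphisms *)

Section Snake.
Variable A : preadditive.
Hypothesis qA : quasi_abelian A.
Variables (M' M M'' N' N N'' : A).
Variables (aM : Mor M' M) (bM : Mor M M'') (aN : Mor N' N) (bN : Mor N N'').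
Variables (f' : Mor M' N') (f : Mor M N) (f'' : Mor M'' N'').
Hypotheses (eM : short_exact aM bM) (eN : short_exact aN bN).
Hypotheses (fa : f ∘ aM = aN ∘ f') (fb : f'' ∘ bM = bN ∘ f).
Variables (C'' : A) (p'' : Mor M'' C'') (i'' : Mor C'' N'').
Hypotheses (cp'' : is_cokernel_map p'') (ki'' : is_kernel_map i'').
Hypothesis (f''E : f'' = i'' ∘ p'').
Variables (K'' : A) (k'' : Mor K'' M'').
Hypothesis (kk'' : is_ker f'' k'').
Variables (Q' : A) (q' : Mor N' Q').
Hypothesis (cq' : is_coker f' q').
(** The form in which slopes enter: the snake map is never constructed, since all morphisms from its
    source to its target are 0. *)
Hypothesis hom0 : forall x : Mor K'' Q', x = 0.
Variables (Q : A) (q : Mor N Q) (j : Mor Q' Q).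
Hypotheses (cq : is_coker f q) (jq : j ∘ q' = q ∘ aN).

(* Push N out along q' to an extension F of N'' by Q'. Since the snake map
   K'' -> Q' vanishes, M'' -> F factors through v : C'' -> F, and Q' embeds in
   F / C'', which receives a map from Q. *)
Lemma snake_monic : is_monic j.
Proof.
have mi'' := kernel_map_monic ki''.
have [F [s [r po]]] := exists_pushout qA aN q'.
have [ra _] := po.
have [w wr [kw cw]] := pushout_short_exact qA eN po; have ws := cw.1.
have [|v0 v0b] := coker_lift (g := r ∘ f) eM.2.
  by rewrite -compmA fa compmA ra -compmA cq'.1 compm0.
have wv0 : w ∘ v0 = f''.
  by apply: (coker_epi eM.2); rewrite -compmA v0b compmA wr fb.
have [|y sy] := ker_lift (g := v0 ∘ k'') kw; first by rewrite compmA wv0 kk''.1.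
have [|v vp] := coker_lift (g := v0) (coim_of_factor cp'' mi'' f''E kk'').
  by rewrite -sy (hom0 y) compm0.
have wv : w ∘ v = i''.
  by apply: (cokernel_map_epi cp''); rewrite -compmA vp wv0.
have kv : is_kernel_map v by apply: (kernel_map_cancel_right qA (g := w)); rewrite wv.
have [T [tau ct]] := exists_coker qA v.
have [|g gq] := coker_lift (g := tau ∘ r) cq.
  by rewrite -compmA -v0b -vp !compmA ct.1 !comp0m.
have gj : g ∘ j = tau ∘ s.
  by apply: (coker_epi cq'); rewrite -!compmA jq -ra !compmA gq.
apply/monicP => X x jx.
have [|c vc] := ker_lift (g := s ∘ x) (ker_of_coker kv ct).
  by rewrite compmA -gj -compmA jx compm0.
have c0 : c = 0 by apply: mi''; rewrite compm0 -wv -compmA vc compmA ws comp0m.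
by apply: (ker_monic kw); rewrite compm0 -vc c0 compm0.
Qed.

Variables (Q'' : A) (q'' : Mor N'' Q'') (cq'' : is_coker f'' q'').
Variables (C' : A) (p' : Mor M' C') (i' : Mor C' N').
Hypotheses (cp' : is_cokernel_map p') (ki' : is_ker q' i').
Hypothesis (f'E : f' = i' ∘ p').
Variables (C : A) (i : Mor C N) (a : Mor C' C).
Hypotheses (ki : is_ker q i) (ia : i ∘ a = aN ∘ i').

Let kiq'' : is_ker q'' i''.
Proof. exact: im_of_factor (cokernel_map_epi cp'') ki'' f''E cq''. Qed.

Lemma snake_coker_map : exists t : Mor Q Q'', t ∘ q = q'' ∘ bN.
Proof.
by apply: (coker_lift cq); rewrite -compmA -fb compmA cq''.1 comp0m.
Qed.

Lemma snake_im_map : exists c : Mor C C'', i'' ∘ c = bN ∘ i.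
Proof.
have [t tq] := snake_coker_map; apply: (ker_lift kiq'').
by rewrite compmA -tq -compmA ki.1 compm0.
Qed.

(** As [p'' ∘ bM] covers C'', some [m] in M has the same image in N'' as [x]; then x - f m lies in
    ker bN, that is, in N'. *)
Lemma snake_lift X (x : Mor X N) (c : Mor X C'') :
  bN ∘ x = i'' ∘ c ->
  exists X' (pi : Mor X' X) (m : Mor X' M) (n : Mor X' N'),
    is_cokernel_map pi /\ x ∘ pi = f ∘ m + aN ∘ n.
Proof.
move=> bx; have cb : is_cokernel_map (p'' ∘ bM).
  by apply: cokernel_map_comp => //; exists M', aM; case: eM.
have [X' [pi [m [cpi pm]]]] := cokernel_map_pull qA c cb.
have [|n an] := ker_lift (g := x ∘ pi - f ∘ m) eN.1.
  rewrite compmBr [bN ∘ (f ∘ m)]compmA -fb f''E -!compmA [p'' ∘ _]compmA pm.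
  by rewrite !compmA bx subrr.
by exists X', pi, m, n; split=> //; rewrite an addrC subrK.
Qed.

(** By [snake_lift], an element of the image is f m + aN n after a cover. Applying [q] gives j (q'
    n) = 0, so [n] lies in the image of [f'] because [j] is monic; lifting it along [p'] shows that
    [p] hits the element. *)
Lemma snake_coim (p : Mor M C) : f = i ∘ p -> is_cokernel_map p.
Proof.
move=> fE; have [c ic] := snake_im_map.
have [X [pi [m [n [cpi e]]]]] := snake_lift (esym ic).
have [|c' ic'] := ker_lift (g := n) ki'.
  apply: snake_monic; rewrite compm0 compmA jq -compmA.
  apply/(addrI (q ∘ (f ∘ m))); rewrite -compmDr -e.
  by rewrite !compmA ki.1 cq.1 !comp0m addr0.
have [Y [rho [m' [crho pm']]]] := cokernel_map_pull qA c' cp'.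
apply: (@cokernel_map_cancel _ qA _ _ _ p (m ∘ rho + aM ∘ m')).
suff -> : p ∘ (m ∘ rho + aM ∘ m') = pi ∘ rho by apply: cokernel_map_comp.
apply: (ker_monic ki).
rewrite [LHS]compmA -fE compmDr !compmA e compmDl fa f'E -!compmA pm'.
by rewrite !compmA -ic' !compmA.
Qed.

(** [c] is a cokernel map because c p = p'' bM is one. An element of ker c comes from some [n] in N'
    with j (q' n) = 0, hence from C'. *)
Lemma snake_im_exact (c : Mor C C'') :
  i'' ∘ c = bN ∘ i -> is_coker a c.
Proof.
move=> ic; have [p ip] := ker_lift ki cq.1.
have mi'' := kernel_map_monic ki''.
have cc : is_cokernel_map c.
  apply: (@cokernel_map_cancel _ qA _ _ _ c p).
  suff -> : c ∘ p = p'' ∘ bM.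
    by apply: cokernel_map_comp => //; exists M', aM; case: eM.
  by apply: mi''; rewrite compmA ic -compmA ip compmA -f''E fb.
apply: coker_of_ker => //; apply: is_kerI.
- by apply: mi''; rewrite compm0 compmA ic -compmA ia compmA eN.1.1 comp0m.
- apply/monicP => X x ax; apply: (ker_monic ki'); apply: (ker_monic eN.1).
  by rewrite !compm0 compmA -ia -compmA ax compm0.
move=> X x cx; have [|n an] := ker_lift (g := i ∘ x) eN.1.
  by rewrite compmA -ic -compmA cx compm0.
have [|c' ic'] := ker_lift (g := n) ki'.
  apply: snake_monic.
  by rewrite compm0 compmA jq -compmA an compmA ki.1 comp0m.
by exists c'; apply: (ker_monic ki); rewrite compmA ia -compmA ic' an.
Qed.

(** Lift an element of ker t to [x] in N. Then bN x lies in C'', so x = f m + aN n after a cover,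
    and [q] sends this to j (q' n). *)
Lemma snake_coker_exact (t : Mor Q Q'') :
  t ∘ q = q'' ∘ bN -> is_ker t j.
Proof.
move=> tq; apply: (ker_local qA snake_monic).
  apply: (coker_epi cq'); rewrite comp0m -compmA jq compmA tq -compmA.
  by rewrite eN.1.1 compm0.
move=> X y ty; have cqm : is_cokernel_map q by exists M, f.
have [X1 [pi [x [cpi qx]]]] := cokernel_map_pull qA y cqm.
have [|c ic] := ker_lift (g := bN ∘ x) kiq''.
  by rewrite compmA -tq -compmA qx compmA ty comp0m.
have [X2 [rho [m [n [crho e]]]]] := snake_lift (esym ic).
exists X2, (pi ∘ rho), (q' ∘ n); split; first exact: cokernel_map_comp.
rewrite compmA jq compmA -qx -[RHS]compmA e compmDr !compmA cq.1 comp0m.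
by rewrite add0r.
Qed.

End Snake.

(** * Slopes *)

Section OrderedGroup.
Variable L : porderZmodType.
Hypothesis L_ordered : ordered_group L.
Hypothesis L_divisible : uniquely_divisible L.
Implicit Types x y z : L.

Lemma ordered_leD x y z t : x <= y -> z <= t -> x + z <= y + t.
Proof.
move=> xy zt; apply: (le_trans (L_ordered.2 _ _ z xy)).
by rewrite ![y + _]addrC; apply: L_ordered.2.
Qed.

Lemma ordered_leD2r z x y : (x + z <= y + z) = (x <= y).
Proof.
by apply/idP/idP => [/(L_ordered.2 _ _ (- z))|/(L_ordered.2 _ _ z)//]; rewrite !addrK.
Qed.

(** Unique divisibility excludes torsion, which is what cancelling [n] requires. *)
Lemma ordered_leMn n x y : (0 < n)%N -> (x *+ n <= y *+ n) = (x <= y).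
Proof.
have mono k z t : z <= t -> z *+ k <= t *+ k.
  by move=> zt; elim: k => [|k IH]; rewrite ?mulr0n // !mulrS ordered_leD.
move=> n0; apply/idP/idP => [xy|]; last exact: mono.
have /orP[//|yx] := L_ordered.1 x y.
have e : x *+ n = y *+ n by apply/le_anti; rewrite xy mono.
by have [z [_ uz]] := L_divisible (x *+ n) n0; rewrite -(uz x erefl) -(uz y (esym e)).
Qed.

End OrderedGroup.

Section Slopes.
Variable L : porderZmodType.
Hypothesis L_ordered : ordered_group L.
Hypothesis L_divisible : uniquely_divisible L.
Variable A : preadditive.
Hypothesis qA : quasi_abelian A.
Variables (rk : A -> nat) (deg : A -> L).
Hypothesis rk_rank : is_rank rk.
Hypothesis deg_degree : is_degree deg.
Let mu := slope rk deg.
Hypothesis mu_slope : is_slope_function mu.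
Implicit Types M N P Q X Y Z K C G : A.
Implicit Types l m : L.

Definition quot_slopes_ge l G : Prop :=
  forall N (p : Mor G N), ~ is_zero N -> is_epi p -> l <= mu N.

Definition sub_slopes_le l G : Prop :=
  forall N (i : Mor N G), ~ is_zero N -> is_monic i -> mu N <= l.

Lemma rk_gt0 M : ~ is_zero M -> (0 < rk M)%N.
Proof. by case: rk_rank => _ _ h /h; rewrite lt0n => /eqP. Qed.

(** Additivity on this sequence reads rk Z = rk Z + rk Z, so rank and degree vanish on zero
    objects. *)
Lemma zero_short_exact Z : is_zero Z -> short_exact (idm Z) (idm Z).
Proof.
move=> zZ; have i0 : idm Z = 0 by apply: zero_from.
split; last by apply: iso_coker => //; apply: iso_id.
apply: is_kerI; first exact: zero_from.
  exact/iso_monic/iso_id.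
by move=> X g _; exists g; rewrite comp1m.
Qed.

Lemma rk_zero Z : is_zero Z -> rk Z = 0%N.
Proof.
case: rk_rank => _ add _ /zero_short_exact /add e.
by apply/eqP; rewrite -(eqn_add2l (rk Z)) addn0 -e.
Qed.

Lemma deg_zero Z : is_zero Z -> deg Z = 0.
Proof.
case: deg_degree => _ add /zero_short_exact /add e.
by apply: (addrI (deg Z)); rewrite addr0 -e.
Qed.

(** The rank is positive, so division is possible and [xget] does not return its default. *)
Lemma slope_rk M : ~ is_zero M -> mu M *+ rk M = deg M.
Proof.
move=> /rk_gt0 /(L_divisible (deg M)) [y [ye _]].
by rewrite /mu /slope; apply: (@xgetPex _ 0 [set y : L | y *+ rk M = deg M]%classic); exists y.
Qed.

Lemma le_slope l M : ~ is_zero M -> (l <= mu M) = (l *+ rk M <= deg M).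
Proof.
by move=> nz; rewrite -slope_rk // ordered_leMn //; apply: rk_gt0.
Qed.

Lemma slope_le l M : ~ is_zero M -> (mu M <= l) = (deg M <= l *+ rk M).
Proof.
by move=> nz; rewrite -slope_rk // ordered_leMn //; apply: rk_gt0.
Qed.

(** This linear form of the slope condition also covers the zero object, sparing later case
    distinctions. *)
Lemma in_slope_deg l C : in_slope mu l C -> deg C = l *+ rk C.
Proof.
case=> [zC|[[nz _] <-]]; first by rewrite deg_zero // rk_zero.
by rewrite slope_rk.
Qed.

(** The quantity deg - l rk is additive and vanishes on P, so it has the same sign on M and N. *)
Lemma le_slope_extension l M N P (f : Mor M N) (g : Mor N P) :
  short_exact f g -> ~ is_zero M -> ~ is_zero N -> in_slope mu l P ->
  (l <= mu M) = (l <= mu N).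
Proof.
move=> ex nM nN /in_slope_deg dP; rewrite !le_slope //.
case: rk_rank => _ /(_ _ _ _ _ _ ex) -> _.
case: deg_degree => _ /(_ _ _ _ _ _ ex) ->.
by rewrite mulrnDr dP ordered_leD2r.
Qed.

Lemma slope_le_extension l M N P (f : Mor M N) (g : Mor N P) :
  short_exact f g -> ~ is_zero P -> ~ is_zero N -> in_slope mu l M ->
  (mu P <= l) = (mu N <= l).
Proof.
move=> ex nM nN /in_slope_deg dP; rewrite !slope_le //.
case: rk_rank => _ /(_ _ _ _ _ _ ex) -> _.
case: deg_degree => _ /(_ _ _ _ _ _ ex) ->.
by rewrite mulrnDr dP ![_ + deg P]addrC ![_ + _ *+ rk P]addrC ordered_leD2r.
Qed.

(** [u] is the canonical morphism Coim -> Im; [coim_monic] and its dual make it a morphism to which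
    the slope axiom applies. *)
Lemma coim_im X Y (f : Mor X Y) : exists C I (p : Mor X C) (u : Mor C I)
    (i : Mor I Y),
  [/\ is_cokernel_map p, is_kernel_map i, f = i ∘ u ∘ p, is_monic u & is_epi u].
Proof.
have [K [k kk]] := exists_ker qA f; have [C [p cp]] := exists_coker qA k.
have [Q [q cq]] := exists_coker qA f; have [I [i ki]] := exists_ker qA q.
have [h hp] := coker_lift cp kk.1.
have [|u iu] := ker_lift (g := h) ki.
  by apply: (coker_epi cp); rewrite comp0m -compmA hp cq.1.
exists C, I, p, u, i; split.
- by exists K, k.
- by exists Q, q.
- by rewrite iu.
- have := coim_monic qA kk cp hp; rewrite -iu => miu Z a b ab.
  by apply: miu; rewrite -!compmA ab.
- have : is_epi (u ∘ p) by apply: (im_epi qA cq ki); rewrite compmA iu.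
  by move=> eup Z a b ab; apply: eup; rewrite !compmA ab.
Qed.

Lemma slope_hom0 l m X Y (f : Mor X Y) :
  m < l -> quot_slopes_ge l X -> sub_slopes_le m Y -> f = 0.
Proof.
move=> ml Xl Ym; have [C [I [p [u [i [cp ki -> mU eu]]]]]] := coim_im f.
have [zC|nC] := pselect (is_zero C).
  by rewrite (zero_from u zC) compm0 comp0m.
have nI : ~ is_zero I by move/(zero_monic mU).
have [uCI _] := mu_slope nC nI mU eu.
have lC := Xl _ p nC (cokernel_map_epi cp).
have Im := Ym _ i nI (kernel_map_monic ki).
by have := lt_le_trans ml (le_trans lC (le_trans uCI Im)); rewrite ltxx.
Qed.

(** The chain l <= mu C <= mu I <= l collapses, so [u] is an isomorphism. C is semistable because
    its subobjects are subobjects of Y. *)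
Lemma slope_hom_admissible l X Y (f : Mor X Y) :
  quot_slopes_ge l X -> sub_slopes_le l Y ->
  exists C (p : Mor X C) (i : Mor C Y),
    [/\ is_cokernel_map p, is_kernel_map i, f = i ∘ p & in_slope mu l C].
Proof.
move=> Xl Yl; have [C [I [p [u [i [cp ki -> mU eu]]]]]] := coim_im f.
suff [iu lC] : is_iso u /\ in_slope mu l C.
  by exists C, p, (i ∘ u); split=> //; apply: kernel_map_comp_iso.
have [zC|nC] := pselect (is_zero C).
  by split; [apply: iso_zero => //; apply: zero_epi eu zC|left].
have nI : ~ is_zero I by move/(zero_monic mU).
have [uCI iffiso] := mu_slope nC nI mU eu.
have lC := Xl _ p nC (cokernel_map_epi cp).
have mi := kernel_map_monic ki; have Il := Yl _ i nI mi.
have Cl : mu C = l by apply/le_anti; rewrite lC (le_trans uCI Il).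
split; first by apply/iffiso/le_anti; rewrite uCI Cl Il.
right; split=> //; split=> // N j nN mj; rewrite Cl.
by apply: (Yl _ (i ∘ u ∘ j) nN); do !apply: monic_comp.
Qed.

(** A quotient E of K pushes out to a quotient P of X that is an extension of C by E. As C has slope
    l, the bound for P passes to E. *)
Lemma ker_quot_slopes l X C (p : Mor X C) K (k : Mor K X) :
  is_cokernel_map p -> in_slope mu l C -> is_ker p k ->
  quot_slopes_ge l X -> quot_slopes_ge l K.
Proof.
move=> cp lC kk Xl E e nE ee.
have [P [s [r po]]] := exists_pushout qA k e.
have [w _ ex] := pushout_short_exact qA (conj kk (coker_of_ker cp kk)) po.
have nP : ~ is_zero P by move/(zero_monic (ker_monic ex.1)).
by rewrite (le_slope_extension ex) //; apply: (Xl _ r nP (pushout_epi po ee)).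
Qed.

(** Dually, a subobject E of Q pulls back to a subobject of Y that is an extension of E by C. *)
Lemma coker_sub_slopes l Y C (i : Mor C Y) Q (q : Mor Y Q) :
  is_kernel_map i -> in_slope mu l C -> is_coker i q ->
  sub_slopes_le l Y -> sub_slopes_le l Q.
Proof.
move=> ki lC cq Yl E e nE me.
have [P [s [r pb]]] := exists_pullback qA q e.
have [w _ ex] := pullback_short_exact qA (conj (ker_of_coker ki cq) cq) pb.
have nP : ~ is_zero P by move/(zero_epi (coker_epi ex.2)).
by rewrite (slope_le_extension ex) //; apply: (Yl _ r nP (pullback_monic pb me)).
Qed.

(** * One step up the filtration *)

Section Level.
Variables (M' M M'' N' N N'' : A).
Variables (aM : Mor M' M) (bM : Mor M M'') (aN : Mor N' N) (bN : Mor N N'').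
Variables (f' : Mor M' N') (f : Mor M N) (l : L).
Hypotheses (kaM : is_kernel_map aM) (cbM : is_coker aM bM).
Hypotheses (kaN : is_kernel_map aN) (cbN : is_coker aN bN).
Hypothesis fa : f ∘ aM = aN ∘ f'.
Hypothesis f'_adm : admissible f'.
Hypothesis f'_hom0 : forall Q' (q' : Mor N' Q'), is_coker f' q' ->
  forall X, quot_slopes_ge l X -> forall x : Mor X Q', x = 0.
Hypotheses (M''l : quot_slopes_ge l M'') (N''l : sub_slopes_le l N'').

Let eM : short_exact aM bM := conj (ker_of_coker kaM cbM) cbM.
Let eN : short_exact aN bN := conj (ker_of_coker kaN cbN) cbN.

(** Vanishing into Coker f' is assumed for slopes >= l but obtained into Coker f only for slopes >=
    m with m > l, since Coker f'' may have subobjects of slope l itself. The next break exceeds l,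
    so this is enough to iterate. *)
Lemma level_step :
  [/\ admissible f,
      (forall Q (q : Mor N Q), is_coker f q ->
         forall m X, l < m -> quot_slopes_ge m X -> forall x : Mor X Q, x = 0),
      (forall Q' (q' : Mor N' Q') Q (q : Mor N Q) (j : Mor Q' Q),
         is_coker f' q' -> is_coker f q -> j ∘ q' = q ∘ aN ->
         is_kernel_map j)
    & (forall Q' (q' : Mor N' Q') C' (i' : Mor C' N')
         Q (q : Mor N Q) C (i : Mor C N) (a : Mor C' C),
         is_coker f' q' -> is_ker q' i' -> is_coker f q -> is_ker q i ->
         i ∘ a = aN ∘ i' ->
         exists G (c : Mor C G), is_coker a c /\ in_slope mu l G)].
Proof.
have [|f'' fb] := coker_lift (g := bN ∘ f) cbM.
  by rewrite -compmA fa compmA cbN.1 comp0m.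
have [C'' [p'' [i'' [cp'' ki'' f''E lC'']]]] := slope_hom_admissible f'' M''l N''l.
have mi'' := kernel_map_monic ki''.
have [K'' [k'' kk'']] := exists_ker qA f''.
have [Q'' [q'' cq'']] := exists_coker qA f''.
have K''l : quot_slopes_ge l K''.
  apply: (ker_quot_slopes (k := k'') cp'' lC'' _ M''l).
  by rewrite -(ker_monic_comp _ _ mi'') -f''E.
have Q''l : sub_slopes_le l Q''.
  apply: (coker_sub_slopes (q := q'') ki'' lC'' _ N''l).
  by rewrite -(coker_epi_comp _ _ (cokernel_map_epi cp'')) -f''E.
have [C'0 [p'0 [i'0 [cp'0 ki'0 f'0]]]] := f'_adm.
have [Q'0 [q'0 cq'0]] := exists_coker qA f'.
have [Q0 [q0 cq0]] := exists_coker qA f; have [C0 [i0 ki0]] := exists_ker qA q0.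
have [j0 jq0] : exists j0, j0 ∘ q'0 = q0 ∘ aN.
  by apply: (coker_lift cq'0); rewrite -compmA -fa compmA cq0.1 comp0m.
have exact_coker Q' (q' : Mor N' Q') Q (q : Mor N Q) (j : Mor Q' Q) :
    is_coker f' q' -> is_coker f q -> j ∘ q' = q ∘ aN ->
    exists t : Mor Q Q'', is_ker t j.
  move=> cq' cq jq.
  have [t tq] := snake_coker_map fb cq cq''; exists t.
  exact: (snake_coker_exact qA eM eN fa fb cp'' ki'' f''E kk'' cq' (f'_hom0 cq' K''l)
    cq jq cq'' tq).
split.
- have [p0 ip0] := ker_lift ki0 cq0.1.
  exists C0, p0, i0; split=> //; last by exists Q0, q0.
  have ki'0q : is_ker q'0 i'0 := im_of_factor (cokernel_map_epi cp'0) ki'0 f'0 cq'0.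
  exact: (snake_coim qA eM eN fa fb cp'' ki'' f''E kk'' cq'0 (f'_hom0 cq'0 K''l)
    cq0 jq0 cq'' cp'0 ki'0q f'0 ki0 (esym ip0)).
- move=> Q q cq m X lm Xm x.
  have [j jq] : exists j, j ∘ q'0 = q ∘ aN.
    by apply: (coker_lift cq'0); rewrite -compmA -fa compmA cq.1 comp0m.
  have [t kt] := exact_coker _ _ _ _ _ cq'0 cq jq.
  (* [x] dies in Coker f'' because l < m, so it comes from Coker f', where [f'_hom0] applies as l <=
     m. *)
  have [|y <-] := ker_lift (g := x) kt; first exact: slope_hom0 lm Xm Q''l.
  suff -> : y = 0 by rewrite compm0.
  apply: (f'_hom0 cq'0) => N0 p nN ep; apply: le_trans (ltW lm) _.
  exact: Xm nN ep.
- by move=> Q' q' Q q j cq' cq /(exact_coker _ _ _ _ _ cq' cq) [t kt]; exists Q'', t.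
move=> Q' q' C' i' Q q C i a cq' ki' cq ki ia.
have [j jq] : exists j, j ∘ q' = q ∘ aN.
  by apply: (coker_lift cq'); rewrite -compmA -fa compmA cq.1 comp0m.
have [c ic] := snake_im_map fb cp'' ki'' f''E cq cq'' ki.
exists C'', c; split=> //.
exact: (snake_im_exact qA eM eN fa fb cp'' ki'' f''E kk'' cq' (f'_hom0 cq' K''l)
  cq jq ki' ki ia ic).
Qed.

End Level.
End Slopes.

(** * Filtrations *)

Section InducedIso.
Variable A : preadditive.

Lemma ker_iso (V W V1 W1 K K1 : A) (f : Mor V W) (f1 : Mor V1 W1)
    (a : Mor V V1) (b : Mor W W1) (k : Mor K V) (k1 : Mor K1 V1)
    (phi : Mor K K1) :
  is_ker f k -> is_ker f1 k1 -> b ∘ f = f1 ∘ a -> is_iso a -> is_monic b ->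
  k1 ∘ phi = a ∘ k -> is_iso phi.
Proof.
move=> kk kk1 bf [v [va av]] mb ke.
have [|psi ks] := ker_lift (g := v ∘ k1) kk.
  apply: mb; rewrite compm0 compmA bf -compmA [a ∘ _]compmA av comp1m.
  exact: kk1.1.
exists psi; split; [apply: (ker_monic kk)|apply: (ker_monic kk1)].
  by rewrite compmA ks -compmA ke compmA va comp1m compm1.
by rewrite compmA ke -compmA ks compmA av comp1m compm1.
Qed.

End InducedIso.

Lemma coker_iso (A : preadditive) (V W V1 W1 Q Q1 : A) (f : Mor V W)
    (f1 : Mor V1 W1) (a : Mor V V1) (b : Mor W W1) (q : Mor W Q)
    (q1 : Mor W1 Q1) (phi : Mor Q Q1) :
  is_coker f q -> is_coker f1 q1 -> b ∘ f = f1 ∘ a -> is_epi a -> is_iso b ->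
  phi ∘ q = q1 ∘ b -> is_iso phi.
Proof.
move=> cq cq1 bf ea [v [vb bv]] e.
have [u [up pu]] : @is_iso (opposite A) _ _ phi.
  apply: (@ker_iso (opposite A) W1 V1 W V Q1 Q f1 f b a q1 q phi) => //.
  by exists v.
by exists u.
Qed.

Section Filtrations.
Variables (L : porderZmodType) (A : preadditive).
Hypothesis L_total : total (<=%R : rel L).
Hypothesis qA : quasi_abelian A.
Implicit Types V W K Q C : lfunctor L A.
Implicit Types l m b : L.

Lemma fmap_trans W l m b (hlm : l <= m) (hmb : m <= b) (hlb : l <= b) X
    (x : Mor X (W l)) :
  fmap W hmb ∘ (fmap W hlm ∘ x) = fmap W hlb ∘ x.
Proof. by rewrite compmA (fmap_comp W hlm hmb hlb). Qed.

(** Kernels are chosen at all indices at once; functoriality is automatic because maps into a kernel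
    are determined by their composite. Membership in [Wpre] is a separate question. *)
Lemma exists_ker_functor V W (f : nattrans V W) :
  exists K (k : nattrans K V), forall l, is_ker (f l) (k l).
Proof.
have ex : forall l, exists S : {X : A & Mor X (V l)},
    is_ker (f l) (projT2 S).
  by move=> l; have [X [k kk]] := exists_ker qA (f l); exists (existT _ X k).
pose S l := sval (cid (ex l)).
have kS l : is_ker (f l) (projT2 (S l)) := svalP (cid (ex l)).
have lift l m (h : l <= m) : exists u : Mor (projT1 (S l)) (projT1 (S m)),
    projT2 (S m) ∘ u = fmap V h ∘ projT2 (S l).
  apply: (ker_lift (kS m)).
  by rewrite compmA nt_natural -compmA (kS l).1 compm0.
pose phi l m h := sval (cid (lift l m h)).
have phiE l m h : projT2 (S m) ∘ phi l m h = fmap V h ∘ projT2 (S l).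
  by rewrite /phi; case: cid.
have phi_id l (h : l <= l) : phi l l h = idm (projT1 (S l)).
  by apply: (ker_monic (kS l)); rewrite phiE fmap_id comp1m compm1.
have phi_comp l m n (hlm : l <= m) (hmn : m <= n) (hln : l <= n) :
    phi l n hln = phi m n hmn ∘ phi l m hlm.
  apply: (ker_monic (kS n)); rewrite compmA !phiE -compmA phiE.
  by rewrite (fmap_trans _ _ hln).
exists (LFunctor phi_id phi_comp).
by exists (@NatTrans L A (LFunctor phi_id phi_comp) V (fun l => projT2 (S l)) phiE).
Qed.

Lemma exists_coker_functor V W (f : nattrans V W) :
  exists Q (q : nattrans W Q), forall l, is_coker (f l) (q l).
Proof.
have ex : forall l, exists S : {X : A & Mor (W l) X},
    is_coker (f l) (projT2 S).
  by move=> l; have [X [k kk]] := exists_coker qA (f l); exists (existT _ X k).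
pose S l := sval (cid (ex l)).
have cS l : is_coker (f l) (projT2 (S l)) := svalP (cid (ex l)).
have lift l m (h : l <= m) : exists u : Mor (projT1 (S l)) (projT1 (S m)),
    u ∘ projT2 (S l) = projT2 (S m) ∘ fmap W h.
  apply: (coker_lift (cS l)).
  by rewrite -compmA -nt_natural compmA (cS m).1 comp0m.
pose phi l m h := sval (cid (lift l m h)).
have phiE l m h : phi l m h ∘ projT2 (S l) = projT2 (S m) ∘ fmap W h.
  by rewrite /phi; case: cid.
have phi_id l (h : l <= l) : phi l l h = idm (projT1 (S l)).
  by apply: (coker_epi (cS l)); rewrite phiE fmap_id comp1m compm1.
have phi_comp l m n (hlm : l <= m) (hmn : m <= n) (hln : l <= n) :
    phi l n hln = phi m n hmn ∘ phi l m hlm.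
  apply: (coker_epi (cS l)); rewrite -compmA !phiE compmA phiE -compmA.
  by rewrite (fmap_comp W hlm hmn hln).
exists (LFunctor phi_id phi_comp).
exists (@NatTrans L A W (LFunctor phi_id phi_comp) (fun l => projT2 (S l))
  (fun l m h => esym (phiE l m h))) => //.
Qed.

Lemma pointwise_ker_lift V W K X (f : nattrans V W) (k : nattrans K V)
    (g : nattrans X V) :
  (forall l, is_ker (f l) (k l)) -> (forall l, f l ∘ g l = 0) ->
  exists u : nattrans X K, forall l, k l ∘ u l = g l.
Proof.
move=> kk fg; have lift l := cid (ker_lift (kk l) (fg l)).
have nat l m (h : l <= m) :
    sval (lift m) ∘ fmap X h = fmap K h ∘ sval (lift l).
  case: (lift m) (lift l) => u /= ku [v /= kv].
  apply: (ker_monic (kk m)).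
  by rewrite !compmA ku !nt_natural -compmA kv.
by exists (NatTrans nat) => l /=; case: (lift l).
Qed.

Lemma pointwise_coker_lift V W Q X (f : nattrans V W) (q : nattrans W Q)
    (g : nattrans W X) :
  (forall l, is_coker (f l) (q l)) -> (forall l, g l ∘ f l = 0) ->
  exists u : nattrans Q X, forall l, u l ∘ q l = g l.
Proof.
move=> kk fg; have lift l := cid (coker_lift (kk l) (fg l)).
have nat l m (h : l <= m) :
    sval (lift m) ∘ fmap Q h = fmap X h ∘ sval (lift l).
  case: (lift m) (lift l) => u /= ku [v /= kv].
  apply: (coker_epi (kk l)).
  by rewrite -!compmA -nt_natural kv compmA ku nt_natural.
by exists (NatTrans nat) => l /=; case: (lift l).
Qed.

Lemma nt_eqP V W (f g : nattrans V W) : f = g <-> forall l, f l = g l.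
Proof. by split=> [->//|]; apply: nattrans_ext. Qed.

Lemma pointwise_is_ker (K V W : Wpre L A) (f : Mor V W) (k : Mor K V) :
  (forall l, is_ker ((f : nattrans _ _) l) ((k : nattrans _ _) l)) ->
  is_ker f k.
Proof.
move=> kk; apply: is_kerI.
- by apply/nt_eqP => l; apply: (kk l).1.
- move=> X g h /nt_eqP e; apply/nt_eqP => l; apply: (ker_monic (kk l)).
  exact: e.
move=> X g /nt_eqP fg; have [u ku] := pointwise_ker_lift kk fg.
by exists u; apply/nt_eqP.
Qed.

(** Fullness of [Wpre] suffices here because Q is taken in [Wpre]; that a pointwise cokernel lies
    there has to be proved. *)
Lemma pointwise_is_coker (V W Q : Wpre L A) (f : Mor V W) (q : Mor W Q) :
  (forall l, is_coker ((f : nattrans _ _) l) ((q : nattrans _ _) l)) ->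
  is_coker f q.
Proof.
move=> kk; apply: is_cokerI.
- by apply/nt_eqP => l; apply: (kk l).1.
- move=> X g h /nt_eqP e; apply/nt_eqP => l; apply: (coker_epi (kk l)).
  exact: e.
move=> X g /nt_eqP fg; have [u ku] := pointwise_coker_lift kk fg.
by exists u; apply/nt_eqP.
Qed.

(** The cocone leg at m is a transition map below b and the inverse of one above b. It serves both
    for the total object and for the part strictly below an index. *)
Lemma colim_attained W (D : pred L) b (Db : D b) :
  (forall m (h : b <= m), D m -> is_iso (fmap W h)) ->
  exists c : forall m, D m -> Mor (W m) (W b),
    [/\ is_colim c, (forall m Dm (h : m <= b), c m Dm = fmap W h)
      & (forall m Dm (h : b <= m), c m Dm ∘ fmap W h = idm (W b))].
Proof.
move=> isoW.
have ex m (Dm : D m) : exists x : Mor (W m) (W b),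
    (forall h : m <= b, x = fmap W h) /\
    (forall h : b <= m, x ∘ fmap W h = idm (W b)).
  have [mb|nmb] := pselect (is_true (m <= b)).
    exists (fmap W mb); split=> h; first by rewrite (bool_irrelevance h mb).
    by rewrite -(fmap_comp W h mb (lexx b)) fmap_id.
  have bm : b <= m by by have [|/nmb] := orP (L_total b m).
  have [x [xf _]] := isoW m bm Dm; exists x; split=> h; first by case: nmb.
  by rewrite (bool_irrelevance h bm).
pose c m Dm := sval (cid (ex m Dm)).
have c1 m Dm (h : m <= b) : c m Dm = fmap W h by rewrite /c; case: cid => x /= [].
have c2 m Dm (h : b <= m) : c m Dm ∘ fmap W h = idm (W b).
  by rewrite /c; case: cid => x /= [].
exists c; split=> //; split.
  move=> l m h Dl Dm; have [mb|bm] := orP (L_total m b).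
    by rewrite (c1 m Dm mb) (c1 l Dl (le_trans h mb)) -(fmap_comp W h mb (le_trans h mb)).
  have [lb|bl] := orP (L_total l b).
    by rewrite (fmap_comp W lb bm h) compmA c2 comp1m -c1.
  apply: (iso_epi (isoW l bl Dl)).
  by rewrite -compmA -(fmap_comp W bl h bm) !c2.
move=> Y d dco; exists (d b Db); split.
  move=> l Dl; have [lb|bl] := orP (L_total l b).
    by rewrite (c1 l Dl lb) dco.
  apply: (iso_epi (isoW l bl Dl)).
  by rewrite -compmA c2 compm1 dco.
by move=> v /(_ b Db); rewrite (c1 b Db (lexx b)) fmap_id compm1.
Qed.

Lemma colim_zero W (D : pred L) (Z : A) :
  is_zero Z -> (forall m, D m -> is_zero (W m)) ->
  @is_colim L A W D Z (fun m Dm => 0).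
Proof.
move=> zZ zW; split=> [l m h Dl Dm|Y d _]; first by rewrite comp0m.
exists 0; split=> [l Dl|v _]; last exact/esym/zero_from.
by rewrite comp0m; apply/esym/zero_from/zW.
Qed.

(** [is_gr] hides its colimit. The comparison map [u] to the hidden one is epi, so it does not
    change the cokernel. *)
Lemma gr_coker W l (V : A) (c : forall m, m < l -> Mor (W m) V) (j : Mor V (W l)) (G : A) :
  @is_colim L A W (fun m => m < l) V c ->
  (forall m (h : m < l), j ∘ c m h = fmap W (ltW h)) ->
  is_gr W l G -> exists q : Mor (W l) G, is_coker j q.
Proof.
move=> [co cu] jc [V' [c' [j' [q [[co' cu'] jc' cq]]]]].
have [v [vc _]] := cu' V c co; have [u [uc _]] := cu V' c' co'.
have [w [_ uw]] := cu' V' c' co'.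
have uv : u ∘ v = idm V'.
  rewrite -(uw (u ∘ v)) => [|m h]; last by rewrite -compmA vc uc.
  by rewrite -(uw (idm V')) // => m h; rewrite comp1m.
have eu : is_epi u.
  by move=> X x y e; rewrite -[x]compm1 -[y]compm1 -uv !compmA e.
have dco : @is_cocone L A W (fun m => m < l) (W l) (fun m h => fmap W (ltW h)).
  by move=> m n h hm hn; rewrite -(fmap_comp W h (ltW hn) (ltW hm)).
have [d [_ ud]] := cu _ _ dco.
exists q; suff <- : j' ∘ u = j by rewrite coker_epi_comp.
by rewrite -(ud j jc) -(ud (j' ∘ u)) // => m h; rewrite -compmA uc jc'.
Qed.

Lemma is_gr_iso V W (phi : nattrans V W) l (G : A) :
  (forall m, is_iso (phi m)) -> is_gr V l G -> is_gr W l G.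
Proof.
move=> iphi [X [c [j [q [[co cu] jc cq]]]]].
have inv m := cid (iphi m).
pose psi m := sval (inv m).
have psiK m : psi m ∘ phi m = idm _ by rewrite /psi; case: (inv m) => ? /= [].
have phiK m : phi m ∘ psi m = idm _ by rewrite /psi; case: (inv m) => ? /= [].
have psi_nat m n (h : m <= n) : fmap V h ∘ psi m = psi n ∘ fmap W h.
  by rewrite -[RHS]compm1 -(phiK m) -compmA [fmap W h ∘ _]compmA -nt_natural
    !compmA psiK comp1m.
exists X, (fun m h => c m h ∘ psi m), (phi l ∘ j), (q ∘ psi l); split.
- split=> [m n h hm hn|Y d dco].
    by rewrite -compmA -psi_nat compmA co.
  have [|u [uc uu]] := cu Y (fun m h => d m h ∘ phi m).
    by move=> m n h hm hn; rewrite -compmA nt_natural compmA dco.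
  exists u; split=> [m h|v vd]; first by rewrite compmA uc -compmA phiK compm1.
  by apply: uu => m h; rewrite -vd -!compmA psiK compm1.
- by move=> m h; rewrite -compmA [j ∘ _]compmA jc psi_nat compmA phiK comp1m.
apply: is_cokerI.
- by rewrite -compmA [psi l ∘ _]compmA psiK comp1m cq.1.
- by apply: (epi_comp (coker_epi cq)); apply: iso_epi; exists (phi l).
move=> Y g gj; have [|u uq] := coker_lift (g := g ∘ phi l) cq.
  by rewrite -compmA.
by exists u; rewrite compmA uq -compmA phiK compm1.
Qed.

(* The list s contains all breaks of W, possibly together with other indices,
   so that one list serves several filtrations at once. *)
Definition constant_off (s : seq L) W : Prop :=
  (forall l, (forall b, b \in s -> ~~ (b <= l)) -> is_zero (W l)) /\
  (forall l m (h : l <= m), (forall b, b \in s -> b <= m -> b <= l) ->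
     is_iso (fmap W h)).

Lemma constant_off_sub (s t : seq L) W :
  {subset s <= t} -> constant_off s W -> constant_off t W.
Proof.
move=> st [zW iW]; split=> [l tl|l m h th].
  by apply: zW => b /st/tl.
by apply: iW => b /st/th.
Qed.

Lemma constant_off_ker s V W K (f : nattrans V W) (k : nattrans K V) :
  (forall l, is_ker (f l) (k l)) -> constant_off s V -> constant_off s W ->
  constant_off s K.
Proof.
move=> kk [zV iV] [_ iW]; split=> [l sl|l m h sh].
  exact: zero_monic (ker_monic (kk l)) (zV l sl).
apply: (ker_iso (kk l) (kk m) _ (iV l m h sh) (iso_monic (iW l m h sh))).
  by rewrite nt_natural.
by rewrite nt_natural.
Qed.

Lemma constant_off_coker s V W Q (f : nattrans V W) (q : nattrans W Q) :
  (forall l, is_coker (f l) (q l)) -> constant_off s V -> constant_off s W ->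
  constant_off s Q.
Proof.
move=> kk [zV iV] [zW iW]; split=> [l sl|l m h sh].
  exact: zero_epi (coker_epi (kk l)) (zW l sl).
apply: (coker_iso (kk l) (kk m) _ (iso_epi (iV l m h sh)) (iW l m h sh)).
  by rewrite nt_natural.
by rewrite nt_natural.
Qed.

Lemma not_le_lt l b : ~~ (b <= l) -> l < b.
Proof.
have /orP[lb nbl|->//] := L_total l b.
by rewrite lt_neqAle lb andbT; apply: contraNN nbl => /eqP ->.
Qed.

Lemma not_lt_le l b : ~~ (l < b) -> b <= l.
Proof. by apply: contraNT => /not_le_lt. Qed.

(** Transition maps become strict monics after composition with the colimit leg, hence are kernels.
    If no break lies in (l, m], then l is before, after or between breaks, and m is in the same
    place. *)
Lemma filtration_constant_off W :
  is_filtration W ->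
  (exists s, constant_off s W) /\
  (forall l m (h : l <= m), is_kernel_map (fmap W h)).
Proof.
move=> [M [c [[co _] sc [s [srt zW iW top]]]]]; split; last first.
  move=> l m h; apply: (kernel_map_cancel (sc m).1).
  by rewrite (co _ _ h isT isT); have [] := sc l; apply: strict_monic_kernel_map.
exists s; split=> [l sl|l m h sh].
  by apply: zW; apply/allP => b /sl/not_le_lt.
have [al|/negP nal] := boolP (all (fun b => l < b) s).
  have am : all (fun b => m < b) s.
    apply/allP => b bs; apply: not_le_lt; apply/negP => /(sh b bs) bl.
    by have := allP al b bs; rewrite (le_gtF bl).
  by apply: iso_zero; apply: zW.
have [bl|] := boolP (all (fun b => b <= l) s).
  have bm : all (fun b => b <= m) s.
    by apply/allP => b /(allP bl)/le_trans; apply.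
  by apply: (iso_cancel_left (g := c m isT)); rewrite ?co; apply: top.
rewrite -has_predC => /hasP [b0 b0s /not_le_lt lb0].
have hs : has (fun b => l < b) s by apply/hasP; exists b0.
have := hs; rewrite has_find; move: (nth_find 0 hs) (@before_find _ 0 (fun b => l < b) s).
(* The first break above [l] is not the head of [s], as [l] does not precede all breaks. With its
   predecessor it bounds an interval containing [l] and [m]. *)
case: (find _ _) => [|i] lk before isz.
  case: nal; case: (s) srt lk => //= x t /(order_path_min lt_trans) xt lx.
  by rewrite lx; apply: sub_all xt => y; apply: lt_trans.
have il : s`_i <= l by apply: not_lt_le; rewrite before.
have mk : m < s`_i.+1.
  apply: not_le_lt; apply/negP => /(sh _ (mem_nth 0 isz)).
  by rewrite (lt_geF lk).
apply: (iso_cancel_right (f := fmap W il)); last exact: iW.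
by rewrite -(fmap_comp W il h (le_trans il h)); apply: iW.
Qed.

Lemma seq_upper_bound (s : seq L) : exists t, forall b, b \in s -> b <= t.
Proof.
elim: s => [|x s [t st]]; first by exists 0.
have [xt|tx] := orP (L_total x t).
  by exists t => b; rewrite inE => /orP[/eqP->//|/st].
by exists x => b; rewrite inE => /orP[/eqP->//|/st /le_trans]; apply.
Qed.

Lemma constant_off_filtration s W :
  constant_off s W -> (forall l m (h : l <= m), is_kernel_map (fmap W h)) ->
  is_filtration W.
Proof.
move=> [zW iW] kW; have [t st] := seq_upper_bound s.
have [|c [cc c1 c2]] := @colim_attained W predT t isT.
  by move=> m h _; apply: iW => b /st.
have ic l : t <= l -> is_iso (c l isT).
  move=> tl; apply: (iso_cancel_right (f := fmap W tl)).
    by rewrite c2; apply: iso_id.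
  by apply: iW => b /st.
exists (W t), c; split=> //.
  move=> l; suff kc : is_kernel_map (c l isT).
    split; first exact: kernel_map_monic.
    by case: qA => _ hk hc _ _; apply: kernel_map_strict.
  have [lt|tl] := orP (L_total l t); first by rewrite (c1 l isT lt).
  rewrite -[c l isT]comp1m; apply: kernel_map_comp_iso (ic l tl).
  exact: idm_kernel_map.
pose s0 := sort <=%R (undup s).
have s0E b : (b \in s0) = (b \in s) by rewrite mem_sort mem_undup.
have ls0 : sorted <=%R s0 by apply: sort_sorted.
exists s0; split.
- by rewrite lt_sorted_uniq_le sort_uniq undup_uniq.
- move=> l /allP sl; apply: zW => b; rewrite -s0E => /sl.
  by move/lt_geF ->.
- move=> i l h isz ll; apply: iW => b; rewrite -s0E => bs bl.
  have bsz : (index b s0 < size s0)%N by rewrite index_mem.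
  rewrite -(nth_index 0 bs).
  (* An entry of index at most i is bounded by the i-th one; a later entry would be at least the
     next break, contradicting b <= l. *)
  have [ji|ij] := leqP (index b s0) i.
    apply: (sorted_leq_nth le_trans lexx 0 ls0) => //; rewrite inE //.
    exact: ltnW.
  have := sorted_leq_nth le_trans lexx 0 ls0 i.+1 (index b s0) isz bsz ij.
  by rewrite nth_index // => /(lt_le_trans ll)/(le_lt_trans bl); rewrite ltxx.
move=> l /allP sl; have [lt|tl] := orP (L_total l t); last exact: ic.
by rewrite (c1 l isT lt); apply: iW => b; rewrite -s0E => /sl.
Qed.

Lemma last_break (s : seq L) l :
  (forall b, b \in s -> ~~ (b < l)) \/
  exists b, [/\ b \in s, b < l & forall b', b' \in s -> b' < l -> b' <= b].
Proof.
elim: s => [|x s IH]; first by left.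
have [xl|xl] := boolP (x < l); last first.
  case: IH => [h|[b [bs bl bm]]]; [left|right; exists b; split=> //].
  - by move=> b; rewrite inE => /orP[/eqP->//|/h].
  - by rewrite inE bs orbT.
  by move=> b'; rewrite inE => /orP[/eqP->|/bm//]; rewrite (negbTE xl).
right; case: IH => [h|[b [bs bl bm]]].
  exists x; rewrite inE eqxx; split=> // b'; rewrite inE.
  by move=> /orP[/eqP->//|/h /negbTE ->].
have [xb|bx] := orP (L_total x b).
  exists b; rewrite inE bs orbT; split=> // b'.
  by rewrite inE => /orP[/eqP->//|/bm].
exists x; rewrite inE eqxx; split=> // b'.
by rewrite inE => /orP[/eqP->//|b's b'l]; apply: le_trans bx; apply: bm.
Qed.

Section Below.
Variables (s : seq L) (l : L).

Lemma zero_below W :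
  constant_off s W -> (forall b, b \in s -> ~~ (b < l)) ->
  forall m, m < l -> is_zero (W m).
Proof.
move=> [zW _] sl m ml; apply: zW => b /sl; apply: contraNN => bm.
exact: le_lt_trans bm ml.
Qed.

(** Here the part strictly below l is a zero object Z, which makes the lowest level an instance of
    [level_step] with M' = N' = Z. *)
Lemma gr_bottom W (Z G : A) :
  constant_off s W -> (forall b, b \in s -> ~~ (b < l)) -> is_zero Z ->
  is_gr W l G <-> exists q : Mor (W l) G, is_coker (0 : Mor Z (W l)) q.
Proof.
move=> cW sl zZ; have zW := zero_below cW sl.
have cc := colim_zero zZ zW.
have jc m (h : m < l) : (0 : Mor Z (W l)) ∘ (0 : Mor (W m) Z) = fmap W (ltW h).
  by rewrite compm0; apply/esym/zero_from/zW.
split=> [|[q cq]]; first exact: gr_coker cc jc.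
by exists Z, (fun m _ => 0), 0, q.
Qed.

Variable b : L.
Hypotheses (bl : b < l) (bm : forall b', b' \in s -> b' < l -> b' <= b).

Lemma iso_between W m (h : b <= m) :
  constant_off s W -> m < l -> is_iso (fmap W h).
Proof.
by move=> [_ iW] ml; apply: iW => b' b's b'm; apply: bm => //; apply: le_lt_trans ml.
Qed.

(** W is constant from the last break b up to l, so the colimit strictly below l is W b. *)
Lemma gr_step W (G : A) :
  constant_off s W ->
  is_gr W l G <-> exists q : Mor (W l) G, is_coker (fmap W (ltW bl)) q.
Proof.
move=> cW; have [|c [cc c1 c2]] := @colim_attained W (fun m => m < l) b bl.
  by move=> m h; apply: iso_between.
have jc m (h : m < l) : fmap W (ltW bl) ∘ c m h = fmap W (ltW h).
  have [mb|bm'] := orP (L_total m b); first by rewrite (c1 m h mb) -(fmap_comp W mb (ltW bl) (ltW h)).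
  apply: (iso_epi (iso_between bm' cW h)).
  by rewrite -compmA c2 compm1 -(fmap_comp W bm' (ltW h) (ltW bl)).
split=> [|[q cq]]; first exact: gr_coker cc jc.
by exists (W b), c, (fmap W (ltW bl)), q.
Qed.

End Below.
End Filtrations.

(** This makes the number of list entries below an index a decreasing measure when passing to the
    preceding break. *)
Lemma count_lt (T : eqType) (P1 P2 : pred T) (s : seq T) (b : T) :
  subpred P1 P2 -> b \in s -> P2 b -> ~~ P1 b -> (count P1 s < count P2 s)%N.
Proof.
move=> P12 + P2b nP1b; elim: s => //= x s IH; rewrite inE => /orP[/eqP <-|bs].
  by rewrite P2b (negbTE nP1b) ltnS sub_count.
rewrite -addnS leq_add //; last exact: IH.
by case P1x: (P1 x) => //; rewrite (P12 _ P1x).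
Qed.

(** * Induction along the breaks and the passage to filtered objects *)

Section Main.
Variable L : porderZmodType.
Hypothesis L_ordered : ordered_group L.
Hypothesis L_divisible : uniquely_divisible L.
Variable A : preadditive.
Hypothesis qA : quasi_abelian A.
Variables (rk : A -> nat) (deg : A -> L).
Hypothesis rk_rank : is_rank rk.
Hypothesis deg_degree : is_degree deg.
Let mu := slope rk deg.
Hypothesis mu_slope : is_slope_function mu.
Let L_total := L_ordered.1.

Lemma in_W_iso (V W : Wpre L A) (phi : Mor V W) :
  is_iso phi -> in_W mu V -> in_W mu W.
Proof.
move=> [psi [/nt_eqP pq /nt_eqP qp]] Vl l.
have [G [grG lG]] := Vl l; exists G; split=> //.
apply: (is_gr_iso (phi := phi) _ grG) => m.
exists ((psi : nattrans _ _) m); split; [exact: pq|exact: qp].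
Qed.

Section Levelwise.
Variables (V W Q C : lfunctor L A).
Variables (f : nattrans V W) (q : nattrans W Q) (i : nattrans C W).
Variable s : seq L.
Hypotheses (cV : constant_off s V) (cW : constant_off s W).
Hypothesis kV : forall l m (h : l <= m), is_kernel_map (fmap V h).
Hypothesis kW : forall l m (h : l <= m), is_kernel_map (fmap W h).
Hypothesis cq : forall l, is_coker (f l) (q l).
Hypothesis ki : forall l, is_ker (q l) (i l).
Hypothesis Vl : forall l, exists G, is_gr V l G /\ quot_slopes_ge rk deg l G.
Hypothesis Wl : forall l, exists G, is_gr W l G /\ sub_slopes_le rk deg l G.

Let cQ : constant_off s Q.
Proof. exact: constant_off_coker cq cV cW. Qed.

Let cC : constant_off s C.
Proof. exact: constant_off_ker ki cW cQ. Qed.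

(** Induction on the number of entries of [s] below [l]: the map on the part strictly below [l] is
    [f b] for the last break [b], and the second conclusion at [b] supplies [f'_hom0] at [l]. *)
Lemma levelwise l :
  [/\ admissible (f l),
      (forall m X, l < m -> quot_slopes_ge rk deg m X ->
         forall x : Mor X (Q l), x = 0),
      (forall m (h : m <= l), is_kernel_map (fmap Q h))
    & exists G, is_gr C l G /\ in_slope mu l G].
Proof.
have [n] := ubnP (count (fun b => b < l) s).
elim: n l => // n IH l /ltnSE cn.
have refl_kernel m (h : m <= l) : l <= m -> is_kernel_map (fmap Q h).
  move=> lm; have e : m = l by apply/le_anti; rewrite h lm.
  by move: h; rewrite e => h; rewrite fmap_id; apply: idm_kernel_map.
have [GV [grV GVl]] := Vl l; have [GW [grW GWl]] := Wl l.
have [sl|[b [bs bl bm]]] := last_break L_total s l.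
  have [Z zZ] := exists_zero qA.
  have [bV cbV] := (gr_bottom GV cV sl zZ).1 grV.
  have [bW cbW] := (gr_bottom GW cW sl zZ).1 grW.
  have cZ : is_coker (0 : Mor Z Z) (idm Z) by apply: iso_coker => //; apply: iso_id.
  have kZ := (zero_short_exact zZ).1.
  have [|||||adm hom0 _ grC] := level_step L_ordered L_divisible qA rk_rank
    deg_degree mu_slope _ cbV _ cbW (f' := 0) (f := f l) (l := l) _ _ _ GVl GWl.
  - exact: zero_kernel_map.
  - exact: zero_kernel_map.
  - by rewrite compm0 comp0m.
  - exact: zero_admissible.
  - by move=> Q' q' cq' X _ x; apply/zero_to/(zero_epi (coker_epi cq')).
  split=> //; first exact: hom0 (cq l).
    move=> m h; have [lm|/(not_le_lt L_total) ml] := boolP (l <= m).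
      exact: refl_kernel.
    by apply: zero_kernel_map; apply: zero_below cQ sl _ ml.
  have [|G [c [cc lG]]] := grC _ _ _ _ _ _ _ _ (0 : Mor Z (C l)) cZ kZ (cq l) (ki l).
    by rewrite compm0 comp0m.
  by exists G; split=> //; apply/(gr_bottom G cC sl zZ); exists c.
have [|admb homb kQb _] := IH b.
  apply: leq_trans cn; apply: (count_lt _ bs bl); last by rewrite ltxx.
  by move=> x /= xb; apply: lt_trans bl.
have [bV cbV] := (gr_step L_total bl bm GV cV).1 grV.
have [bW cbW] := (gr_step L_total bl bm GW cW).1 grW.
have [|||adm hom0 kQ grC] := level_step L_ordered L_divisible qA rk_rank
  deg_degree mu_slope (kV (ltW bl)) cbV (kW (ltW bl)) cbW (f' := f b)
  (f := f l) (l := l) _ _ _ GVl GWl.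
- exact: nt_natural.
- exact: admb.
(* The induction hypothesis concerns the chosen cokernel [Q b]; it is transported to an arbitrary
   one. *)
- move=> Q' q' cq' X Xl x; have [u iu _] := coker_unique cq' (cq b).
  by apply: (iso_monic iu); rewrite compm0; apply: homb Xl _.
split=> //; first exact: hom0 (cq l).
  have kbl : is_kernel_map (fmap Q (ltW bl)).
    by apply: (kQ _ _ _ _ _ (cq b) (cq l)); rewrite nt_natural.
  move=> m h; have [lm|/(not_le_lt L_total) ml] := boolP (l <= m).
    exact: refl_kernel.
  have [mb|bm'] := orP (L_total m b).
    by rewrite (fmap_comp Q mb (ltW bl) h); apply: kernel_map_comp.
  (* No break lies in (b, m], so Q m -> Q l is Q b -> Q l up to an isomorphism. *)
  have [v [vf fv]] := iso_between bm bm' cQ ml.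
  suff -> : fmap Q h = fmap Q (ltW bl) ∘ v.
    by apply: kernel_map_comp_iso => //; exists (fmap Q bm').
  by rewrite (fmap_comp Q bm' h (ltW bl)) -compmA fv compm1.
have [|G [c [cc lG]]] :=
  grC _ _ _ _ _ _ _ _ (fmap C (ltW bl)) (cq b) (ki b) (cq l) (ki l).
  exact: nt_natural.
by exists G; split=> //; apply/(gr_step L_total bl bm G cC); exists c.
Qed.

End Levelwise.

(** The pointwise image C serves as both coimage and image, so the canonical morphism is the
    identity. *)
Lemma strict_and_im_in_W (M N : Wpre L A) (f : Mor M N) :
  in_Wudq mu M -> in_Wuds mu N ->
  is_strict f /\
  exists (C : Wpre L A) (p : Mor M C) (i : Mor C N),
    [/\ is_coim f p, is_im f i & in_W mu C].
Proof.
move: M N f => [V fV] [W fW] /= f Vl Wl.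
have [[sV cV] kV] := filtration_constant_off L_total fV.
(* The concatenated list serves both filtrations, hence also their pointwise kernel, cokernel and
   image. *)
have [[sW cW] kW] := filtration_constant_off L_total fW.
have {}cV : constant_off (sV ++ sW) V.
  by apply: constant_off_sub cV => b; rewrite mem_cat => ->.
have {}cW : constant_off (sV ++ sW) W.
  by apply: constant_off_sub cW => b; rewrite mem_cat => ->; rewrite orbT.
have [K [k kk]] := exists_ker_functor qA f.
have [Q [q cq]] := exists_coker_functor qA f.
have [C [i ki]] := exists_ker_functor qA q.
have lev := levelwise cV cW kV kW cq ki Vl Wl.
have [p ip] := pointwise_ker_lift ki (fun l => (cq l).1).
have cK := constant_off_ker kk cV cW.
have cQ := constant_off_coker cq cV cW.
have cC := constant_off_ker ki cW cQ.
have fK : is_filtration K.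
  apply: (constant_off_filtration L_total qA cK) => l m h.
  apply: (kernel_map_cancel (ker_monic (kk m))); rewrite nt_natural.
  by apply: kernel_map_comp => //; exists (W l), (f l).
(* Here the slopes are needed; K and C are pointwise kernels, so their transition maps are kernels
   anyway. *)
have fQ : is_filtration Q.
  apply: (constant_off_filtration L_total qA cQ) => l m h.
  by have [] := lev m.
have fC : is_filtration C.
  apply: (constant_off_filtration L_total qA cC) => l m h.
  apply: (kernel_map_cancel (ker_monic (ki m))); rewrite nt_natural.
  by apply: kernel_map_comp => //; exists (Q l), (q l).
pose MC : Wpre L A := exist _ C fC.
pose MM : Wpre L A := exist _ V fV.
pose MN : Wpre L A := exist _ W fW.
pose MK : Wpre L A := exist _ K fK.
pose MQ : Wpre L A := exist _ Q fQ.
have coim_p : @is_coim (Wpre L A) MM MN f MC p.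
  exists MK, k; split; first exact: pointwise_is_ker.
  apply: pointwise_is_coker => l; have [adm _ _ _] := lev l.
  have cp := admissible_coim adm (cq l) (ki l) (esym (ip l)).
  exact: coim_of_factor cp (ker_monic (ki l)) (esym (ip l)) (kk l).
have im_i : @is_im (Wpre L A) MM MN f MC i.
  exists MQ, q; split; first exact: pointwise_is_coker.
  exact: pointwise_is_ker.
split; last by exists MC, p, i; split=> // l; have [] := lev l.
exists MC, p, MC, i, (idm MC); split=> //; last exact: iso_id.
by apply/nt_eqP => l /=; rewrite compm1.
Qed.

End Main.

Theorem corollary3p1p8
  (L : porderZmodType) (L_ordered : ordered_group L)
  (L_divisible : uniquely_divisible L)
  (A : preadditive) (A_quasi_abelian : quasi_abelian A)
  (rk : A -> nat) (rk_rank : is_rank rk)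
  (deg : A -> L) (deg_degree : is_degree deg)
  (mu_slope : is_slope_function (slope rk deg))
  (M N : Wpre L A) (f : Mor M N)
  (M_udq : in_Wudq (slope rk deg) M) (N_uds : in_Wuds (slope rk deg) N) :
  is_strict f /\
  (forall (C : Wpre L A) (p : Mor M C), is_coim f p -> in_W (slope rk deg) C) /\
  (forall (I : Wpre L A) (i : Mor I N), is_im f i -> in_W (slope rk deg) I).
Proof.
have [sf [D [p [i [[K [k [kk cp]]] [Q [q [cq ki]]] Dl]]]]] :=
  strict_and_im_in_W L_ordered L_divisible A_quasi_abelian rk_rank deg_degree
    mu_slope f M_udq N_uds.
split=> //; split=> [C p' [K' [k' [kk' cp']]]|I i' [Q' [q' [cq' ki']]]].
  (* Two kernels of [f] differ by an isomorphism, which does not affect their cokernels; so any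
     coimage is isomorphic to the constructed D. *)
  have [u iu ku] := ker_unique kk kk'.
  move: cp; rewrite -ku coker_epi_comp; last exact: iso_epi.
  by move=> /coker_unique /(_ cp') [v iv _]; apply: in_W_iso iv Dl.
have [u iu uq] := coker_unique cq' cq.
move: ki; rewrite -uq ker_monic_comp; last exact: iso_monic.
by move=> /ker_unique /(_ ki') [v iv _]; apply: in_W_iso iv Dl.
Qed.
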